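(* Consider $D_x,D_x^x,Z_x:\mathbb R^{N_xK+1}\to\mathbb R^{N_xK-1}$ defined with test functions in $V^K_{\Delta x,0}$ and trial functions in $V^K_{\Delta x}$. Then: (a) the kernel of $D^x_x$ is $\langle1,x\rangle$; (b) the kernel of $Z_x$ contains $\langle1,x\rangle$; (c) the kernel of $D_x$ is $\langle1,w\rangle$ with $w$ a non-constant function with discontinuities in the first derivative at each cell interface; (d) the kernel of $Z_x$ does not contain $w$.
   Context: Let $K\ge1$ and let $\Omega^x=\bigcup_{i=0}^{N_x-1}E_i$ be an interval divided into $N_x$ cells $E_i=[x_i,x_{i+1}]$ of equal length $\Delta x$. $V^K_{\Delta x}$ is the space of continuous functions on $\Omega^x$ that are polynomials of degree $\le K$ on each cell (dimension $N_xK+1$), with Lagrange basis $\varphi_\alpha$, $0\le\alpha\le N_xK$, at the Gauss–Lobatto points ($K+1$ per cell, endpoints shared); $V^K_{\Delta x,0}$ is its subspace of functions vanishing at both endpoints of $\Omega^x$, spanned by $\varphi_\alpha$, $1\le\alpha\le N_xK-1$. $1$ and $x$ denote the constant function and the coordinate function, and $\langle\cdot\rangle$ the linear span. For $u_h\in V^K_{\Delta x}$ and test functions $\varphi\in V^K_{\Delta x,0}$, $D_xu$ is given by $\int_{\Omega^x}\varphi\,\partial_xu_h\,dx$ and $D^x_xu$ by $\int_{\Omega^x}\partial_x\varphi\,\partial_xu_h\,dx$. Moreover $Z_x=D^x_x-D^xM^{-1}D_x$, where in the second term: $M_{\alpha\beta}=\int\varphi_\alpha\varphi_\beta\,dx$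 (evaluated with the Gauss–Lobatto quadrature at the nodes, hence diagonal and invertible) and $(D_x)_{\alpha\beta}=\int\varphi_\alpha\partial_x\varphi_\beta\,dx$ are the full $(N_xK+1)\times(N_xK+1)$ matrices with test and trial functions in $V^K_{\Delta x}$, while $(D^x)_{\alpha\beta}=\int\partial_x\varphi_\alpha\,\varphi_\beta\,dx$ has test functions $\varphi_\alpha\in V^K_{\Delta x,0}$ and trial functions $\varphi_\beta\in V^K_{\Delta x}$.
   Formalization: Part (d), that the kernel of Z_x does not contain w, is stated only for N_x ≥ 2, because for a single cell (N_x = 1) one has Z_x = 0 and its kernel is the whole space. *)

(* Defs.v *)
From mathcomp Require Import all_boot all_order all_algebra.
From mathcomp Require Import polyrcf.
From mathcomp Require Import all_classical all_reals all_analysis.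

Set Implicit Arguments.
Unset Strict Implicit.
Unset Printing Implicit Defensive.

Import Order.TTheory GRing.Theory Num.Theory.
Import numFieldNormedType.Exports.

Local Open Scope classical_set_scope.
Local Open Scope ring_scope.

(* Below, K is the polynomial degree, N the number of cells, x0 the left
   endpoint of the interval and dx the length of a cell. *)

(* Rodrigues' formula. *)
Definition legendre (R : realType) (K : nat) : {poly R} :=
  (2 ^+ K * K`!%:R)^-1 *: (('X^2 - 1) ^+ K)^`(K).

(* The K+1 Gauss-Lobatto points of the reference cell [-1, 1], in increasing
   order: its endpoints and the zeros of the derivative of the K-th Legendre
   polynomial. *)
Definition gl_node (R : realType) (K j : nat) : R :=
  (rootsR (('X^2 - 1) * deriv (legendre R K)))`_j.

Definition gl_lagrange (R : realType) (K j : nat) : {poly R} :=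
  \prod_(k < K.+1 | k != j :> nat)
    ((gl_node R K j - gl_node R K k)^-1 *: ('X - (gl_node R K k)%:P)).

Definition gl_weight (R : realType) (K j : nat) : R :=
  \int[lebesgue_measure]_(t in `[(-1 : R), 1]) (gl_lagrange R K j).[t].

Definition cell_bound (R : realType) (x0 dx : R) (i : nat) : R :=
  x0 + i%:R * dx.

Definition omega (R : realType) (N : nat) (x0 dx : R) : set R :=
  `[cell_bound x0 dx 0, cell_bound x0 dx N].

(* The j-th Gauss-Lobatto point of the i-th cell. *)
Definition cell_node (R : realType) (K : nat) (x0 dx : R) (i j : nat) : R :=
  cell_bound x0 dx i + dx * ((1 + gl_node R K j) / 2).

(* Local point j of cell i has global index i * K + j, so that the last point
   of a cell and the first point of the next one get the same index. *)
Definition node (R : realType) (K : nat) (x0 dx : R) (a : nat) : R :=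
  cell_node K x0 dx (a %/ K) (a %% K).

(* Index of a cell containing x: an interface is attributed to the cell on its
   right, the right endpoint of the interval to the last cell. *)
Definition cell_of (R : realType) (N : nat) (x0 dx x : R) : nat :=
  minn (Num.truncn ((x - x0) / dx)) N.-1.

(* The a-th Lagrange basis function; it is only meaningful on omega. *)
Definition phi (R : realType) (K N : nat) (x0 dx : R) (a : nat) (x : R) : R :=
  let i := cell_of N x0 dx x in
  \sum_(j < K.+1 | (i * K + j)%N == a)
    (gl_lagrange R K j).[2 * ((x - cell_bound x0 dx i) / dx) - 1].

(* The element of V^K_dx with coefficients u in the Lagrange basis. *)
Definition fe_fun (R : realType) (K N : nat) (x0 dx : R)
    (u : 'cV[R]_(N * K).+1) (x : R) : R :=
  \sum_(a < (N * K).+1) u a 0 * phi K N x0 dx a x.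

(* The coefficients of f in the Lagrange basis, for f in V^K_dx. *)
Definition nodal (R : realType) (K N : nat) (x0 dx : R) (f : R -> R) :
    'cV[R]_(N * K).+1 :=
  \col_(a < (N * K).+1) f (node K x0 dx a).

Definition gl_quad (R : realType) (K N : nat) (x0 dx : R) (f : R -> R) : R :=
  \sum_(i < N) \sum_(j < K.+1)
    dx / 2 * gl_weight R K j * f (cell_node K x0 dx i j).

Definition integral_omega (R : realType) (N : nat) (x0 dx : R) (f : R -> R) : R :=
  \int[lebesgue_measure]_(x in omega N x0 dx) f x.

Definition mx_mass (R : realType) (K N : nat) (x0 dx : R) :
    'M[R]_((N * K).+1, (N * K).+1) :=
  \matrix_(a, b)
    gl_quad K N x0 dx (fun x => phi K N x0 dx a x * phi K N x0 dx b x).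

Definition mx_Dx_full (R : realType) (K N : nat) (x0 dx : R) :
    'M[R]_((N * K).+1, (N * K).+1) :=
  \matrix_(a, b)
    integral_omega N x0 dx
      (fun x => phi K N x0 dx a x * derive1 (phi K N x0 dx b) x).

(* In the matrices with (N * K).-1 rows, row a is the test function with index
   a + 1: the first and last basis functions do not vanish at the endpoints.
   The derivatives of the basis functions have no meaning at the interfaces,
   which are negligible. *)

Definition mx_Dx (R : realType) (K N : nat) (x0 dx : R) :
    'M[R]_((N * K).-1, (N * K).+1) :=
  \matrix_(a, b)
    integral_omega N x0 dx
      (fun x => phi K N x0 dx a.+1 x * derive1 (phi K N x0 dx b) x).

(* D^x: the derivative is on the test function. *)
Definition mx_Dtest (R : realType) (K N : nat) (x0 dx : R) :
    'M[R]_((N * K).-1, (N * K).+1) :=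
  \matrix_(a, b)
    integral_omega N x0 dx
      (fun x => derive1 (phi K N x0 dx a.+1) x * phi K N x0 dx b x).

Definition mx_Dxx (R : realType) (K N : nat) (x0 dx : R) :
    'M[R]_((N * K).-1, (N * K).+1) :=
  \matrix_(a, b)
    integral_omega N x0 dx
      (fun x => derive1 (phi K N x0 dx a.+1) x * derive1 (phi K N x0 dx b) x).

Definition mx_Zx (R : realType) (K N : nat) (x0 dx : R) :
    'M[R]_((N * K).-1, (N * K).+1) :=
  mx_Dxx K N x0 dx
    - mx_Dtest K N x0 dx *m invmx (mx_mass K N x0 dx) *m mx_Dx_full K N x0 dx.

Definition ker (R : realType) (m n : nat) (A : 'M[R]_(m, n)) : {vspace 'cV[R]_n} :=
  lker (linfun (mulmx A : 'cV[R]_n -> 'cV[R]_m)).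

Definition constant_on (R : realType) (A : set R) (f : R -> R) : Prop :=
  exists c, forall x, A x -> f x = c.

(* Jump discontinuity of the derivative. *)
Definition derivative_jump (R : realType) (f : R -> R) (x : R) : Prop :=
  exists l r : R, [/\ derive1 f y @[y --> x^'-] --> l,
                      derive1 f y @[y --> x^'+] --> r & l != r].

(* Main.v *)
Require Import Defs.
From mathcomp Require Import all_boot all_order all_algebra.
From mathcomp Require Import polyrcf polyorder cauchyreals.
From mathcomp Require Import all_classical all_reals all_analysis.
From mathcomp Require Import measurable_realfun.
From mathcomp Require Import ring lra zify.

(** Write L for the K-th Legendre polynomial and s for (-1)^K. Transported to the
    reference cell [-1, 1], every matrix entry is a sum over the cells of integrals
    of polynomials (integral_omega_cells), and the statement reduces to three facts
    about L: it is orthogonal to all polynomials of degree less than K, it satisfies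
    L(-1) = s L(1), and all its roots and those of L' lie strictly between -1 and 1,
    by repeated use of Rolle's theorem in Rodrigues' formula.

    D_xx. An element of the kernel, minus the affine function with the same values
    at both endpoints, can be tested against itself; its derivative has zero norm,
    so it is zero (ker_Dxx).

    D_x. The inner test functions of a cell span the multiples of 1 - X^2 of degree
    at most K; the polynomials of degree less than K that are orthogonal to them are
    the multiples of L'. So the derivative of a kernel element is c_i L' on cell i, and the
    test functions at the interfaces force c_(i+1) = s c_i (ker_Dx). The function w
    equal to s^i L on cell i is continuous; its derivative changes sign across each
    interface and does not vanish there (w_jump).

    Z_x. The quadrature is exact up to degree 2K - 1 (gl_exact), which makes its
    weights positive (ref_int_lagrange_gt0) and the mass matrix M invertible. The
    weights are the integrals of the Lagrange polynomials, so M^-1 D_x x = 1, and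
    both terms of Z_x vanish on 1 and on x (mulDx_full_pos). For w, integration by
    parts leaves in D_x w only the contributions of the two endpoints of the
    interval, and testing Z_x w with the hat function of the first interface gives
    a nonzero number (mulZx_w_neq0). *)

Set Implicit Arguments.
Unset Strict Implicit.
Unset Printing Implicit Defensive.

Import Order.TTheory GRing.Theory Num.Theory.
Import numFieldNormedType.Exports.

Local Open Scope classical_set_scope.
Local Open Scope ring_scope.

(** * Integrals of polynomials over [-1, 1], and their roots *)

Lemma path_le_last d (T : porderType d) (x : T) (s : seq T) :
  path <%O x s -> {in x :: s, forall y, (y <= last x s)%O}.
Proof.
elim: s x => [|z s IHs] x /=; first by move=> _ y; rewrite inE => /eqP ->.
move=> /andP[xz /IHs le_last] y; rewrite inE => /predU1P[->|/le_last//].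
by apply: (le_trans (ltW xz)); apply: le_last; rewrite mem_head.
Qed.

Section polynomial_integral.
Variable R : realType.
Implicit Types p q : {poly R}.

Lemma deriv_eq0_const p : p^`() = 0 -> p = (p`_0)%:P.
Proof.
move=> p'0; apply: size1_polyC.
by have := size_deriv p; rewrite p'0 size_poly0; case: (size p) => [|[]].
Qed.

(** The coefficient at i = 0 is a division by zero, that is 0. *)
Definition primitive p : {poly R} := \poly_(i < (size p).+1) (p`_i.-1 / i%:R).

Lemma deriv_primitive p : (primitive p)^`() = p.
Proof.
apply/polyP => i; rewrite coef_deriv coef_poly /= ltnS.
case: ltnP => [_|pi]; last by rewrite mul0rn nth_default.
by rewrite -[LHS]mulr_natr divfK// pnatr_eq0.
Qed.

(** The integral over the reference cell [-1, 1]. Going through the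
    antiderivative makes linearity and integration by parts algebraic;
    Rintegral_horner links it to the Lebesgue integral. *)
Definition ref_int p : R := (primitive p).[1] - (primitive p).[-1].

Lemma ref_int_deriv p : ref_int p^`() = p.[1] - p.[-1].
Proof.
have /deriv_eq0_const : (primitive p^`() - p)^`() = 0.
  by rewrite derivB deriv_primitive subrr.
move=> /(canRL (subrK _)) e.
by rewrite /ref_int e !hornerD !hornerC; ring.
Qed.

Lemma ref_int_D p q : ref_int (p + q) = ref_int p + ref_int q.
Proof.
rewrite -{1}(deriv_primitive p) -{1}(deriv_primitive q) -derivD ref_int_deriv !hornerD.
by rewrite /ref_int; ring.
Qed.

Lemma ref_int_Z c p : ref_int (c *: p) = c * ref_int p.
Proof.
by rewrite -{1}(deriv_primitive p) -derivZ ref_int_deriv !hornerZ /ref_int mulrBr.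
Qed.

Lemma ref_int_Zl c p q : ref_int (c *: p * q) = c * ref_int (p * q).
Proof. by rewrite -scalerAl ref_int_Z. Qed.

Lemma ref_int_Zr c p q : ref_int (p * (c *: q)) = c * ref_int (p * q).
Proof. by rewrite -scalerAr ref_int_Z. Qed.

Lemma ref_int_0 : ref_int 0 = 0.
Proof. by rewrite -(scale0r 0) ref_int_Z mul0r. Qed.

Lemma ref_int_sum (I : Type) (r : seq I) (P : pred I) (F : I -> {poly R}) :
  ref_int (\sum_(i <- r | P i) F i) = \sum_(i <- r | P i) ref_int (F i).
Proof. by elim/big_rec2: _ => [|i x y _ <-]; rewrite ?ref_int_0// ref_int_D. Qed.

Lemma ref_int_parts p q :
  ref_int (p * q^`()) = p.[1] * q.[1] - p.[-1] * q.[-1] - ref_int (p^`() * q).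
Proof.
by rewrite -!hornerM -ref_int_deriv derivM ref_int_D addrAC subrr add0r.
Qed.

(** The antiderivative is nondecreasing on [-1, 1]; with equal values at both
    ends it would be constant there, hence everywhere, and p would vanish. *)
Lemma ref_int_gt0 p : {in `[-1, 1], forall x, 0 <= p.[x]} -> p != 0 -> 0 < ref_int p.
Proof.
move=> p_ge0 p_neq0; set P := primitive p.
have mono : {in `[-1, 1] &, {homo horner P : x y / x <= y}}.
  apply: ler_hornerW => x x11; rewrite deriv_primitive; apply: p_ge0.
  by apply: subset_itv_oo_cc x11.
have m11 : (-1 : R) <= 1 by rewrite -subr_ge0 opprK addr_ge0 ?ler01.
have m1 : (-1 : R) \in `[-1, 1] by rewrite in_itv/= lexx m11.
have p1 : (1 : R) \in `[-1, 1] by rewrite in_itv/= m11 lexx.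
rewrite lt_neqAle subr_ge0 (mono _ _ m1 p1 m11) andbT.
rewrite eq_sym; apply: contra_neq p_neq0 => /eqP; rewrite subr_eq0 => /eqP P11.
(* Any infinite family of points of [-1, 1] would do for the roots. *)
have P_cst : P = (P.[1])%:P.
  apply/eqP; rewrite -subr_eq0; apply/eqP.
  apply: (@poly_ltsp_roots _ _
    (mkseq (fun k => k.+1%:R^-1) (size (P - P.[1]%:P)))).
  - by rewrite size_mkseq.
  - apply: mkseq_uniq => i j /invr_inj/eqP.
    by rewrite eqr_nat eqSS => /eqP.
  - apply/allP => x /mapP[k _ ->]; rewrite rootE !hornerE subr_eq0 eq_le.
    have k1 : (k.+1%:R^-1 : R) \in `[-1, 1].
      rewrite in_itv/=; apply/andP; split.
        by rewrite (@le_trans _ _ 0)// ?invr_ge0 ?ler0n//; lra.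
      by rewrite invf_le1 ?ler1n ?ltr0n.
    have := k1; rewrite in_itv/= => /andP[k11 k12].
    by rewrite mono//= P11 mono.
by rewrite -(deriv_primitive p) -/P P_cst derivC.
Qed.

(** Rolle's theorem in each gap between consecutive roots. The last clause says
    that the new roots stay away from the last old one: it is what allows the
    endpoints to be put back before the next application. *)
Lemma rolle_path p (x : R) (s : seq R) : path <%R x s -> all (root p) (x :: s) ->
  exists s', [/\ path <%R x s', size s' = size s, all (root p^`()) s'
    & {in s', forall y, y < last x s}].
Proof.
elim: s x => [|y s IHs] x /=; first by exists [::].
move=> /andP[xy ys] /and3P[/eqP px py ps].
have [|s' [ys' ss' rs' s'_lt]] := IHs y ys; first by rewrite /= py.
have [|c] := @poly_rolle _ x y p xy; first by rewrite px (eqP py).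
rewrite in_itv/= => /andP[xc cy] pc.
exists (c :: s'); split => //=; rewrite ?xc ?ss' ?rs' ?rootE ?pc ?eqxx//.
  by case: s' ys' {ss' rs' s'_lt} => //= z s' /andP[yz ->]; rewrite (lt_trans cy yz).
move=> z; rewrite inE => /predU1P[->|/s'_lt//].
apply: (lt_le_trans cy); apply: path_le_last => //; exact: mem_head.
Qed.

End polynomial_integral.

(** * Legendre polynomials and Gauss-Lobatto quadrature *)

Section legendre_polynomial.
Variables (R : realType).
Implicit Types p q : {poly R}.

Local Notation X21 := ('X^2 - 1 : {poly R}).

(** Each derivation costs at most one factor p. *)
Lemma derivn_exp_dvd p n m : exists q, (p ^+ n)^`(m) = p ^+ (n - m) * q.
Proof.
elim: m => [|m [q IHm]]; first by exists 1; rewrite subn0 mulr1.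
rewrite derivnS IHm derivM deriv_exp subnS.
by case: (n - m)%N => [|k] /=; [exists q^`(); rewrite expr0; rewrite mulr0n; ring
  | exists (p^`() * q *+ k.+1 + p * q^`()); rewrite exprS -mulr_natl; ring].
Qed.

Lemma size_X21 : size X21 = 3%N.
Proof. by rewrite -[1]expr1 -polyC1 size_XnsubC. Qed.

Lemma X21_neq0 : X21 != 0. Proof. by rewrite -size_poly_gt0 size_X21. Qed.

Lemma X21_root : (X21.[1] = 0) * (X21.[-1] = 0).
Proof. by split; rewrite !hornerE ?sqrrN ?expr1n subrr. Qed.

Lemma rodrigues_root K m : (m < K)%N ->
  (((X21 ^+ K)^`(m)).[1] = 0) * (((X21 ^+ K)^`(m)).[-1] = 0).
Proof.
move=> mK; have [q ->] := derivn_exp_dvd X21 K m.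
have Km : (0 < K - m)%N by lia.
by split; rewrite hornerM horner_exp !hornerE ?sqrrN ?expr1n subrr expr0n
  eqn0Ngt Km mul0r.
Qed.

(** Below order K, the endpoints -1 and 1 are roots besides the m inner ones, so
    that Rolle's theorem gains one root per derivation. *)
Lemma rodrigues_zeros K m : (m <= K)%N ->
  exists s, [/\ path <%R (-1) (rcons s 1), size s = m
    & all (root ((X21 ^+ K)^`(m))) s].
Proof.
elim: m => [|m IHm] mK.
  by exists [::]; split => //=; rewrite andbT; lra.
have [s [ps ss rs]] := IHm (ltnW mK).
have [|s' [ps' ss' rs' s'lt]] := rolle_path (p := (X21 ^+ K)^`(m)) ps.
  by rewrite /= all_rcons rs !rootE !(rodrigues_root mK) eqxx.
exists s'; split; last by rewrite derivnS.
  rewrite rcons_path ps'/=; have := mem_last (-1) s'; rewrite inE.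
  by move=> /predU1P[->|/s'lt]; rewrite ?last_rcons//; lra.
by rewrite ss' size_rcons ss.
Qed.

(** Integrating by parts m times kills q, and the boundary terms vanish by
    rodrigues_root. *)
Lemma rodrigues_orthogonal K m q : (m <= K)%N -> (size q <= m)%N ->
  ref_int (q * (X21 ^+ K)^`(m)) = 0.
Proof.
elim: m q => [|m IHm] q mK sq.
  by rewrite (_ : q = 0) ?mul0r ?ref_int_0//; apply/eqP; rewrite -size_poly_leq0.
rewrite derivnS ref_int_parts !(rodrigues_root mK) !mulr0 IHm ?subrr//; first exact: ltnW.
by rewrite size_deriv; move: (size q) sq => [|n].
Qed.

Variable K : nat.
Local Notation L := (legendre R K).

Let legendre_scale : exists2 c : R, c != 0 & L = c *: (X21 ^+ K)^`(K).
Proof.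
eexists; last reflexivity.
by rewrite invr_eq0 mulf_neq0// ?expf_neq0// pnatr_eq0// -lt0n fact_gt0.
Qed.

Local Opaque legendre.

Lemma size_legendre : size L = K.+1.
Proof.
have [c c0 ->] := legendre_scale.
rewrite size_scale// size_derivn my_size_exp ?X21_neq0// size_X21/=; lia.
Qed.

Lemma legendre_neq0 : L != 0.
Proof. by rewrite -size_poly_gt0 size_legendre. Qed.

Lemma legendre_zeros : exists s,
  [/\ path <%R (-1) (rcons s 1), size s = K & all (root L) s].
Proof.
have [s [ps ss rs]] := rodrigues_zeros (leqnn K).
exists s; split => //; have [c c0 ->] := legendre_scale.
by apply: sub_all rs => x; rewrite rootZ.
Qed.

Lemma deriv_legendre_zeros : exists s,
  [/\ path <%R (-1) (rcons s 1), size s = K.-1 & all (root L^`()) s].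
Proof.
have [[|x s] [ps ss rs]] := legendre_zeros.
  by exists [::]; rewrite -ss; split => //=; rewrite andbT; lra.
move: ps; rewrite rcons_path /= => /andP[/andP[x1 ps] s1].
have [s' [ps' ss' rs' s'lt]] := rolle_path ps rs.
exists s'; split => //; last by rewrite ss' -ss.
rewrite rcons_path; apply/andP; split.
  by case: s' ps' {ss' rs' s'lt} => //= y s' /andP[xy ->]; rewrite (lt_trans x1 xy).
have := mem_last (-1) s'; rewrite inE => /predU1P[->|/s'lt]; first by lra.
by move=> /lt_trans; apply.
Qed.

Lemma legendre_orthogonal q : (size q <= K)%N -> ref_int (q * L) = 0.
Proof.
have [c c0 ->] := legendre_scale; rewrite -scalerAr ref_int_Z => sq.
by rewrite rodrigues_orthogonal// mulr0.
Qed.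

(** Derivation exchanges even and odd polynomials, and X^2 - 1 is even. *)
Lemma legendreN : L \Po (- 'X) = (-1) ^+ K *: L.
Proof.
have [c c0 ->] := legendre_scale; rewrite linearZ/= scalerA mulrC -scalerA.
congr (_ *: _).
suff H m : (X21 ^+ K)^`(m) \Po (- 'X) = (-1) ^+ m *: (X21 ^+ K)^`(m) by [].
elim: m => [|m IHm].
  rewrite !derivn0 expr0 scale1r rmorphXn/= rmorphB/= rmorphXn/=.
  by rewrite comp_polyX rmorph1 sqrrN.
have := congr1 (fun p => p^`()) IHm.
rewrite deriv_comp derivZ derivN derivX !derivnS mulrN1 => /(canRL (@opprK _)) ->.
by rewrite (exprSr (-1 : R)) mulrN1 scaleNr.
Qed.

Lemma legendre_m1 : L.[-1] = (-1) ^+ K * L.[1].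
Proof. by rewrite -hornerZ -legendreN horner_comp !hornerE. Qed.

Lemma deriv_legendre_m1 : L^`().[-1] = - ((-1) ^+ K * L^`().[1]).
Proof.
rewrite -hornerZ -derivZ -legendreN deriv_comp derivN derivX mulrN1.
by rewrite hornerN opprK horner_comp !hornerE.
Qed.

Lemma path_uniq1 (s : seq R) : path <%R (-1) (rcons s 1) -> uniq (1 :: s).
Proof.
move=> ps; rewrite [uniq _]/= -rcons_uniq.
have : uniq (-1 :: rcons s 1) by exact: (sorted_uniq lt_trans ltxx).
by case/andP.
Qed.

(** The K roots of L are already accounted for inside ]-1, 1[. *)
Lemma legendre1_neq0 : L.[1] != 0.
Proof.
have [s [ps ss rs]] := legendre_zeros.
apply: contra_neq legendre_neq0 => L1.
apply: (@poly_ltsp_roots _ _ (1 :: s)); rewrite /= ?rootE ?L1 ?eqxx//.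
  by rewrite size_legendre ss.
exact: path_uniq1.
Qed.

Hypothesis K_gt0 : (0 < K)%N.

Lemma size_deriv_legendre : size L^`() = K.
Proof. by rewrite size_deriv size_legendre. Qed.

Lemma deriv_legendre_neq0 : L^`() != 0.
Proof. by rewrite -size_poly_gt0 size_deriv_legendre. Qed.

Lemma deriv_legendre1_neq0 : L^`().[1] != 0.
Proof.
have [s [ps ss rs]] := deriv_legendre_zeros.
apply: contra_neq deriv_legendre_neq0 => L1.
apply: (@poly_ltsp_roots _ _ (1 :: s)); rewrite /= ?rootE ?L1 ?eqxx//.
  by rewrite size_deriv_legendre ss; lia.
exact: path_uniq1.
Qed.

Local Notation B := (X21 * L^`()).

Lemma size_gl_poly : size B = K.+2.
Proof.
rewrite size_mul ?X21_neq0 ?deriv_legendre_neq0// size_X21 size_deriv_legendre.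
by lia.
Qed.

Lemma gl_poly_neq0 : B != 0.
Proof. by rewrite -size_poly_gt0 size_gl_poly. Qed.

(** The endpoints and the K - 1 inner roots of L' exhaust the degree, so that
    they are the list of all the roots. *)
Lemma gl_nodes : exists s, [/\ rootsR B = -1 :: rcons s 1, size s = K.-1,
  path <%R (-1) (rcons s 1) & all (root L^`()) s].
Proof.
have [s [ps ss rs]] := deriv_legendre_zeros.
exists s; split => //.
have rB : all (root B) (-1 :: rcons s 1).
  rewrite /= all_rcons !rootE !hornerM !hornerE sqrrN expr1n subrr !mul0r.
  by rewrite eqxx/=; apply: sub_all rs => x; rewrite rootM orbC => ->.
apply: (@irr_sorted_eq _ _ (@lt_trans _ R) (@ltxx _ R)); rewrite ?sorted_roots//.
move=> x; rewrite -(roots_on_rootsR gl_poly_neq0) in_itv/=.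
apply/idP/idP => [Bx|/(allP rB)//].
apply: contraNT gl_poly_neq0 => xs; apply/eqP.
apply: (@poly_ltsp_roots _ _ (x :: -1 :: rcons s 1)); last by rewrite /= Bx.
  by rewrite size_gl_poly/= size_rcons ss; lia.
rewrite cons_uniq xs; exact: (sorted_uniq lt_trans ltxx).
Qed.

Lemma gl_node0 : gl_node R K 0 = -1.
Proof. by have [s [e _ _ _]] := gl_nodes; rewrite /gl_node e. Qed.

Lemma gl_nodeK : gl_node R K K = 1.
Proof.
have [s [e ss _ _]] := gl_nodes; rewrite /gl_node e -{1}(prednK K_gt0) -ss/=.
by rewrite nth_rcons ltnn eqxx.
Qed.

Lemma size_gl_nodes : size (rootsR B) = K.+1.
Proof.
by have [s [-> ss _ _]] := gl_nodes; rewrite /= size_rcons ss prednK.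
Qed.

Lemma gl_node_inj j k : (j <= K)%N -> (k <= K)%N ->
  (gl_node R K j == gl_node R K k) = (j == k).
Proof.
move=> jK kK; rewrite /gl_node nth_uniq ?size_gl_nodes//.
exact: (sorted_uniq lt_trans ltxx (sorted_roots _ _ _)).
Qed.

Lemma gl_node_root j : (j <= K)%N -> root B (gl_node R K j).
Proof.
move=> jK; have : gl_node R K j \in rootsR B by rewrite mem_nth// size_gl_nodes.
by rewrite -(roots_on_rootsR gl_poly_neq0) => /andP[].
Qed.

Lemma gl_node_deriv_root j : (0 < j < K)%N -> root L^`() (gl_node R K j).
Proof.
case/andP; case: j => // j _ jK; have [s [e ss _ /allP rs]] := gl_nodes.
rewrite /gl_node e /= nth_rcons ss ifT; last by lia.
by apply/rs/mem_nth; rewrite ss; lia.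
Qed.

Lemma gl_node_itv j : (j <= K)%N -> gl_node R K j \in `[-1, 1].
Proof.
move=> jK; have : gl_node R K j \in rootsR B by rewrite mem_nth// size_gl_nodes.
have [s [-> _ ps _]] := gl_nodes; rewrite inE in_itv/= => /predU1P[->|].
  by apply/andP; split; lra.
move=> js; have /allP/(_ _ js)/ltW -> := order_path_min lt_trans ps.
by have := path_le_last ps; rewrite last_rcons; apply; rewrite inE js orbT.
Qed.

Lemma gl_poly_eq p q : (size p <= K.+1)%N -> (size q <= K.+1)%N ->
  (forall j, (j <= K)%N -> p.[gl_node R K j] = q.[gl_node R K j]) -> p = q.
Proof.
move=> sp sq pq; apply/eqP; rewrite -subr_eq0; apply/eqP.
apply: (@poly_ltsp_roots _ _ (mkseq (gl_node R K) K.+1)).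
- by rewrite size_mkseq (leq_trans (size_polyD _ _))// size_polyN geq_max sp.
- apply/mkseq_uniqP => i j; rewrite !inE !ltnS => iK jK /eqP.
  by rewrite gl_node_inj// => /eqP.
- apply/allP => x /mapP[j]; rewrite mem_iota add0n ltnS => /= jK ->.
  by rewrite rootE !hornerE pq// subrr.
Qed.

Lemma lagrange_node j k : (j <= K)%N -> (k <= K)%N ->
  (gl_lagrange R K j).[gl_node R K k] = (k == j)%:R.
Proof.
move=> jK kK; rewrite /gl_lagrange horner_prod; case: eqVneq => [->|kj].
  apply: big1 => i ij; rewrite !hornerE mulVf// subr_eq0 gl_node_inj//.
    by rewrite eq_sym.
  by rewrite -ltnS.
have kK1 : (k < K.+1)%N by [].
by rewrite (bigD1 (Ordinal kK1))//= !hornerE subrr mulr0 mul0r.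
Qed.

Lemma size_lagrange j : (j <= K)%N -> (size (gl_lagrange R K j) <= K.+1)%N.
Proof.
move=> jK; rewrite /gl_lagrange.
have jK1 : (j < K.+1)%N by [].
rewrite (eq_bigl (mem (predC1 (Ordinal jK1))))// (eq_bigr (fun k : 'I_K.+1 =>
  (gl_node R K j - gl_node R K k)^-1%:P * ('X - (gl_node R K k)%:P))); last first.
  by move=> k _; rewrite mul_polyC.
rewrite big_split/= -rmorph_prod/= mul_polyC (leq_trans (size_scale_leq _ _))//.
by rewrite -big_enum size_prod_XsubC -cardE cardC1 card_ord.
Qed.

Lemma lagrange_interp (f : nat -> R) k : (k <= K)%N ->
  (\sum_(j < K.+1) f j *: gl_lagrange R K j).[gl_node R K k] = f k.
Proof.
move=> kK; have kK1 : (k < K.+1)%N by [].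
rewrite horner_sum (bigD1 (Ordinal kK1))//= hornerZ lagrange_node// eqxx mulr1.
rewrite big1 ?addr0// => j jk; rewrite hornerZ lagrange_node//; last by rewrite -ltnS.
by rewrite eq_sym -(inj_eq val_inj)/= in jk; rewrite (negPf jk) mulr0.
Qed.

Lemma size_lagrange_interp (f : nat -> R) :
  (size (\sum_(j < K.+1) f j *: gl_lagrange R K j)%R <= K.+1)%N.
Proof.
apply: (leq_trans (size_sum _ _ _)); apply/bigmax_leqP => j _.
by rewrite (leq_trans (size_scale_leq _ _))// size_lagrange// -ltnS.
Qed.

Lemma lagrange_expand p : (size p <= K.+1)%N ->
  p = \sum_(j < K.+1) p.[gl_node R K j] *: gl_lagrange R K j.
Proof.
move=> sp; apply: gl_poly_eq => //.
  exact: (size_lagrange_interp (fun j => p.[gl_node R K j])).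
by move=> j jK; rewrite (lagrange_interp (fun j => p.[gl_node R K j])).
Qed.

(** Integration by parts: the boundary terms vanish with X^2 - 1, and the
    derivative of (X^2 - 1) q has degree less than K, hence is orthogonal to L. *)
Lemma ref_int_bubble q : (size q < K)%N -> ref_int (B * q) = 0.
Proof.
move=> sq; rewrite (_ : B * q = X21 * q * L^`()); last by ring.
rewrite ref_int_parts !hornerM !X21_root !mul0r.
rewrite legendre_orthogonal ?subrr// size_deriv.
have := size_polyMleq X21 q; rewrite size_X21.
by move: (size _) (size q) sq => a b; lia.
Qed.

(** A polynomial of degree at most 2K - 1 differs from its interpolant at the
    nodes by a multiple of the nodal polynomial whose cofactor has degree at most
    K - 2; by ref_int_bubble the difference has zero integral. *)
Lemma gl_exact p : (size p <= K.*2)%N ->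
  ref_int p = \sum_(j < K.+1) p.[gl_node R K j] * ref_int (gl_lagrange R K j).
Proof.
move=> sp; have Bu : lead_coef B \is a GRing.unit.
  by rewrite unitfE lead_coef_eq0 gl_poly_neq0.
have e := divp_eq p B.
have sr : (size (p %% B)%R <= K.+1)%N.
  by rewrite -ltnS -size_gl_poly ltn_modp gl_poly_neq0.
have sd : (size (p %/ B)%R < K)%N.
  by rewrite size_divp ?gl_poly_neq0// size_gl_poly; move: (size p) sp => n; lia.
have pr j : (j < K.+1)%N -> p.[gl_node R K j] = (p %% B).[gl_node R K j].
  move=> jK; rewrite {1}e hornerD hornerM (rootP (gl_node_root _))//.
  by rewrite mulr0 add0r.
rewrite {1}e ref_int_D mulrC ref_int_bubble// add0r {1}(lagrange_expand sr) ref_int_sum.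
by apply: eq_bigr => j _; rewrite ref_int_Z pr.
Qed.

(** By exactness, the integral of p is its value at node j times the weight of
    that node. *)
Lemma ref_int_lagrange_gt0_witness p j : (j <= K)%N -> (size p <= K.*2)%N -> p != 0 ->
  {in `[-1, 1], forall x, 0 <= p.[x]} ->
  (forall k, (k <= K)%N -> k != j -> p.[gl_node R K k] = 0) ->
  0 < ref_int (gl_lagrange R K j).
Proof.
move=> jK sp p0 p_ge0 pk0; have := ref_int_gt0 p_ge0 p0.
have jK1 : (j < K.+1)%N by [].
rewrite gl_exact// (bigD1 (Ordinal jK1))//= big1 ?addr0.
  have pj : 0 <= p.[gl_node R K j] by apply/p_ge0/gl_node_itv.
  by move=> /[dup] Hpos; rewrite pmulr_rgt0// lt_neqAle pj andbT eq_sym;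
    apply: contraTneq Hpos => ->; rewrite mul0r ltxx.
move=> k kj; rewrite pk0 ?mul0r// -1?ltnS//.
Qed.

(** Witnesses of degree at most 2K - 1: (1 - X) L'^2 at -1, (1 + X) L'^2 at 1,
    and (1 - X^2) (L' / (X - g))^2 at an inner node g. A square of the Lagrange
    polynomial itself would have degree 2K, one too many. *)
Lemma ref_int_lagrange_gt0 j : (j <= K)%N -> 0 < ref_int (gl_lagrange R K j).
Proof.
move=> jK; have L0 := deriv_legendre_neq0.
have rL k : (0 < k < K)%N -> L^`().[gl_node R K k] = 0.
  by move=> /gl_node_deriv_root/rootP.
have sLL : (size (L^`() ^+ 2) = K.*2.-1)%N.
  by rewrite my_size_exp// size_deriv_legendre; lia.
have [j0|j0] := posnP j.
  apply: (@ref_int_lagrange_gt0_witness ((1 - 'X) * L^`() ^+ 2)) => //.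
  - rewrite (leq_trans (size_polyMleq _ _))// sLL.
    rewrite -opprB size_polyN size_XsubC; lia.
  - by rewrite mulf_neq0 ?expf_neq0// -opprB oppr_eq0 polyXsubC_eq0.
  - move=> x; rewrite in_itv/= => /andP[_ x1].
    by rewrite hornerM horner_exp mulr_ge0 ?sqr_ge0// !hornerE subr_ge0.
  - move=> k kK kj; have [->|kK'] := eqVneq k K.
      by rewrite gl_nodeK hornerM hornerD hornerN hornerX hornerC subrr mul0r.
    by rewrite hornerM horner_exp rL ?expr0n ?mulr0//; lia.
have [jK'|jK'] := eqVneq j K.
  apply: (@ref_int_lagrange_gt0_witness ((1 + 'X) * L^`() ^+ 2)) => //.
  - rewrite (leq_trans (size_polyMleq _ _))// sLL.
    rewrite addrC -[1]opprK -polyCN size_XsubC; lia.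
  - by rewrite mulf_neq0 ?expf_neq0// addrC -[1]opprK -polyCN polyXsubC_eq0.
  - move=> x; rewrite in_itv/= => /andP[x1 _].
    by rewrite hornerM horner_exp mulr_ge0 ?sqr_ge0// !hornerE -lerBlDl sub0r.
  - move=> k kK kj; have [->|kK'] := posnP k.
      by rewrite gl_node0 hornerM hornerD hornerX hornerC subrr mul0r.
    by rewrite hornerM horner_exp rL ?expr0n ?mulr0//; lia.
have /gl_node_deriv_root/factor_theorem[T LT] : (0 < j < K)%N by lia.
have T0 : T != 0 by apply: contra_neq L0 => T0; rewrite LT T0 mul0r.
have sT : size T = K.-1.
  have := size_deriv_legendre; rewrite {1}LT size_mul ?polyXsubC_eq0// size_XsubC.
  by rewrite addn2 /= => <-.
apply: (@ref_int_lagrange_gt0_witness (- X21 * T ^+ 2)) => //.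
- rewrite (leq_trans (size_polyMleq _ _))// size_polyN size_X21 my_size_exp// sT; lia.
- by rewrite mulf_neq0 ?expf_neq0// oppr_eq0 X21_neq0.
- move=> x; rewrite in_itv/= => /andP[x1 x2].
  by rewrite hornerM horner_exp mulr_ge0 ?sqr_ge0// !hornerE oppr_ge0 subr_le0 expr2; nra.
- move=> k kK kj; have [->|k0] := posnP k.
    by rewrite gl_node0 hornerM hornerN X21_root oppr0 mul0r.
  have [->|kK'] := eqVneq k K.
    by rewrite gl_nodeK hornerM hornerN X21_root oppr0 mul0r.
  rewrite hornerM horner_exp (_ : T.[_] = 0) ?expr0n ?mulr0//.
  have : L^`().[gl_node R K k] = 0 by apply: rL; lia.
  rewrite LT hornerM hornerXsubC => /eqP; rewrite mulf_eq0 subr_eq0 gl_node_inj//.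
  by rewrite (negPf kj) orbF => /eqP.
Qed.

End legendre_polynomial.

(** * Lebesgue integrals of piecewise polynomials *)

Section integration.
Variable R : realType.
Implicit Types (p q : {poly R}) (f : R -> R) (a b c : R).
Local Notation mu := (@lebesgue_measure R).

Lemma integrable_horner p a b : mu.-integrable `[a, b] (EFin \o horner p).
Proof.
apply: continuous_compact_integrable; first exact: segment_compact.
exact/continuous_subspaceT/continuous_horner.
Qed.

Lemma Rintegral_horner p a b : a < b ->
  \int[mu]_(x in `[a, b]) p^`().[x] = p.[b] - p.[a].
Proof.
move=> ab; rewrite /Rintegral (@continuous_FTC2 _ _ (horner p))//.
- exact/continuous_subspaceT/continuous_horner.
- split; first by move=> x _; exact: derivable_horner.
  + exact/cvg_at_right_filter/continuous_horner.
  + exact/cvg_at_left_filter/continuous_horner.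
- by move=> x _; rewrite derivE.
Qed.

Lemma gl_weightE (K j : nat) : gl_weight R K j = ref_int (gl_lagrange R K j).
Proof.
rewrite /gl_weight -{1}(deriv_primitive (gl_lagrange R K j)) Rintegral_horner//.
Qed.

(** The values of f at a and b are arbitrary: this is the situation of the
    derivative of a basis function at an interface. *)
Lemma integrable_itv_eq_poly f p a b : a < b ->
  {in `]a, b[, forall x, f x = p.[x]} ->
  mu.-integrable `[a, b] (EFin \o f) /\
  \int[mu]_(x in `[a, b]) f x = \int[mu]_(x in `[a, b]) p.[x].
Proof.
move=> ab fp.
have ip := integrable_horner p a b.
have ipoo : mu.-integrable `]a, b[ (EFin \o horner p).
  by apply: integrableS ip => //; exact: subset_itv_oo_cc.
have ifoo : mu.-integrable `]a, b[ (EFin \o f).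
  by apply: eq_integrable ipoo => //= x; rewrite inE /= => xab; rewrite fp.
have mf : measurable_fun `[a, b] f.
  apply/measurable_fun_itv_bndo_bndcP/measurable_fun_itv_obnd_cbndP.
  by apply/measurable_EFinP; exact: (measurable_int mu).
have eoo : `]a, b[%classic = `[a, b] `\` ([set a] `|` [set b]).
  apply/seteqP; split => x /=; rewrite !in_itv/=.
    move=> /andP[ax xb]; rewrite !ltW//; split => // -[xa|xb'].
      by rewrite xa ltxx in ax.
    by rewrite xb' ltxx in xb.
  move=> [/andP[ax xb] /not_orP[/eqP xa /eqP xb']].
  by rewrite !lt_neqAle ax xb eq_sym xa xb'.
have N0 : mu ([set a] `|` [set b]) = 0%E.
  by rewrite measureU0//; exact: lebesgue_measure_set1.
have ifcc : mu.-integrable `[a, b] (EFin \o f).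
  apply/(@negligible_integrable _ _ _ mu _ ([set a] `|` [set b])); rewrite -?eoo//.
    exact: measurableU.
  exact/measurable_EFinP.
have cc_oo (g : R -> R) : mu.-integrable `[a, b] (EFin \o g) ->
    \int[mu]_(x in `[a, b]) g x = \int[mu]_(x in `]a, b[) g x.
  move=> ig; rewrite -Rintegral_itv_obnd_cbnd -?Rintegral_itv_bndo_bndc//.
    by apply: integrableS ig => //; exact: subset_itv_oo_cc.
  by apply: integrableS ig => //; exact: subset_itv_oc_cc.
split => //; rewrite !cc_oo//; apply: eq_Rintegral => x.
by rewrite inE/= => xab; rewrite fp.
Qed.

Lemma Rintegral_itv_cat f a b c : a <= b -> b <= c ->
  mu.-integrable `[a, b] (EFin \o f) ->
  mu.-integrable `[b, c] (EFin \o f) ->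
  mu.-integrable `[a, c] (EFin \o f) /\
  \int[mu]_(x in `[a, c]) f x =
  \int[mu]_(x in `[a, b]) f x + \int[mu]_(x in `[b, c]) f x.
Proof.
move=> ab bc iab ibc.
have ibc' : mu.-integrable `]b, c] (EFin \o f).
  by apply: integrableS ibc => //; exact: subset_itv_oc_cc.
have eU : `[a, c]%classic = `[a, b] `|` `]b, c]%classic.
  by rewrite -itv_bndbnd_setU// bnd_simp.
have disj : [disjoint `[a, b] & `]b, c]%classic].
  apply/disj_setPS => y [/=]; rewrite !in_itv/= => /andP[_ yb] /andP[].
  by rewrite ltNge yb.
have mf : measurable_fun (`[a, b] `|` `]b, c]%classic) f.
  by apply/measurable_funU => //; split; apply/measurable_EFinP;
    exact: (measurable_int mu).
have iac : mu.-integrable `[a, c] (EFin \o f).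
  rewrite eU; apply/integrableP; split; first exact/measurable_EFinP.
  rewrite ge0_integral_setU//; last first.
    by apply: measurableT_comp => //; exact/measurable_EFinP.
  by apply: lte_add_pinfty; [case/integrableP: iab|case/integrableP: ibc'].
split=> //; rewrite -(Rintegral_itv_obnd_cbnd ibc') eU Rintegral_setU//.
by rewrite -eU.
Qed.

End integration.

Section cells.
Variables (R : realType) (N : nat) (x0 dx : R).
Hypothesis dx_gt0 : 0 < dx.
Implicit Types (p q : {poly R}) (f : R -> R) (i : nat) (x : R).
Local Notation mu := (@lebesgue_measure R).
Local Notation xb := (cell_bound x0 dx).

(** The affine map from a cell onto [-1, 1], taken as a polynomial so that a
    function on a cell is a composition of polynomials. *)
Definition cell_coord i : {poly R} := (2 / dx) *: ('X - (xb i)%:P) - 1.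

Lemma cell_coordE i x : (cell_coord i).[x] = 2 * ((x - xb i) / dx) - 1.
Proof. by rewrite /cell_coord !hornerE/=; ring. Qed.

Lemma cell_boundS i : xb i.+1 = xb i + dx.
Proof. by rewrite /cell_bound -addn1 natrD; ring. Qed.

Lemma cell_bound_lt i : xb i < xb i.+1.
Proof. by rewrite cell_boundS ltrDl. Qed.

Lemma cell_coord_left i : (cell_coord i).[xb i] = -1.
Proof. by rewrite cell_coordE subrr mul0r mulr0 sub0r. Qed.

Lemma cell_coord_right i : (cell_coord i).[xb i.+1] = 1.
Proof.
by rewrite cell_coordE cell_boundS addrAC subrr add0r divff ?gt_eqF//; ring.
Qed.

Lemma deriv_comp_cell_coord q i :
  (q \Po cell_coord i)^`() = (2 / dx) *: (q^`() \Po cell_coord i).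
Proof.
rewrite deriv_comp {2}/cell_coord -polyC1 derivB derivZ derivB derivX !derivC.
by rewrite !subr0 -!mul_polyC mulr1 mulrC.
Qed.

Lemma Rintegral_cell q i :
  \int[mu]_(x in `[xb i, xb i.+1]) (q \Po cell_coord i).[x] = dx / 2 * ref_int q.
Proof.
have -> : q \Po cell_coord i = ((dx / 2) *: (primitive q \Po cell_coord i))^`().
  rewrite derivZ deriv_comp_cell_coord deriv_primitive scalerA.
  by rewrite (_ : dx / 2 * (2 / dx) = 1) ?scale1r//; field; rewrite gt_eqF.
rewrite Rintegral_horner ?cell_bound_lt// !hornerZ !horner_comp.
by rewrite cell_coord_left cell_coord_right -mulrBr.
Qed.

(** This is how Lebesgue integrals disappear: all integrands below are, on each
    open cell, polynomials in the reference coordinate. *)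
Lemma integral_omega_cells f (q : nat -> {poly R}) :
  (forall i x, (i < N)%N -> x \in `]xb i, xb i.+1[ ->
    f x = (q i).[(cell_coord i).[x]]) ->
  integral_omega N x0 dx f = \sum_(i < N) dx / 2 * ref_int (q i).
Proof.
move=> fq; rewrite /integral_omega /omega.
suff [] : mu.-integrable `[xb 0, xb N] (EFin \o f) /\
    \int[mu]_(x in `[xb 0, xb N]) f x = \sum_(i < N) dx / 2 * ref_int (q i) by [].
elim: N fq => [|n IHn] fq.
  rewrite set_itv1 Rintegral_set1 big_ord0; split=> //.
  apply: null_set_integrable => //.
    exact: measurable_fun_set1.
  exact: lebesgue_measure_set1.
have [||icell ecell] := @integrable_itv_eq_poly _ f (q n \Po cell_coord n) (xb n) (xb n.+1).
- exact: cell_bound_lt.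
- by move=> x xn; rewrite horner_comp; apply: fq.
have [|in_ en] := IHn; first by move=> i x iN; apply: fq; rewrite ltnS ltnW.
have [||i1 e1] := Rintegral_itv_cat _ _ in_ icell.
- by rewrite /cell_bound mul0r addr0 lerDl mulr_ge0// ltW.
- exact/ltW/cell_bound_lt.
by rewrite big_ord_recr/= e1 en ecell Rintegral_cell.
Qed.

Lemma derive1_cell f q i x : x \in `]xb i, xb i.+1[ ->
  {in `]xb i, xb i.+1[, forall y, f y = q.[(cell_coord i).[y]]} ->
  derive1 f x = 2 / dx * q^`().[(cell_coord i).[x]].
Proof.
move=> xi fq; rewrite derive1E (@near_eq_derive _ _ _ _ (horner (q \Po cell_coord i))).
  by rewrite -derive1E -derivE deriv_comp_cell_coord hornerZ horner_comp.
near=> y; rewrite fq ?horner_comp//; near: y.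
exact: near_in_itvoo.
Unshelve. all: by end_near. Qed.

Lemma cell_of_eq i x : (i < N)%N -> xb i <= x < xb i.+1 -> cell_of N x0 dx x = i.
Proof.
move=> iN /andP[xi xi1]; rewrite /cell_of (@truncn_def _ _ i).
  by apply/minn_idPl; rewrite -ltnS prednK//; case: N iN.
rewrite ler_pdivlMr// ltr_pdivrMr// lerBrDl ltrBlDl.
by move: xi xi1; rewrite /cell_bound => -> ->.
Qed.

Lemma cell_of_last : (0 < N)%N -> cell_of N x0 dx (xb N) = N.-1.
Proof.
move=> N0; rewrite /cell_of /cell_bound addrAC subrr add0r mulfK ?gt_eqF//.
rewrite natrK; apply/minn_idPr; exact: leq_pred.
Qed.

End cells.

(** * The Lagrange basis *)

Section basis.
Variables (R : realType) (K N : nat) (x0 dx : R).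
Hypotheses (K_gt0 : (0 < K)%N) (dx_gt0 : 0 < dx).
Implicit Types (p q : {poly R}) (a i j : nat) (x : R) (v : nat -> R).
Local Notation xb := (cell_bound x0 dx).
Local Notation g := (gl_node R K).

(** Restrictions to cell i, in the reference coordinate: cell_basis of the a-th
    basis function, cell_fun of the function with coefficients v. Coefficients
    are indexed by nat so that i * K + j needs no bound. *)
Definition cell_basis a i : {poly R} :=
  \sum_(j < K.+1 | (i * K + j)%N == a) gl_lagrange R K j.

Definition cell_fun v i : {poly R} :=
  \sum_(j < K.+1) v (i * K + j)%N *: gl_lagrange R K j.

Lemma cell_fun_node v i j : (j <= K)%N -> (cell_fun v i).[g j] = v (i * K + j)%N.
Proof.
by move=> jK; rewrite (lagrange_interp K_gt0 (fun j => v (i * K + j)%N)).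
Qed.

Lemma size_cell_fun v i : (size (cell_fun v i) <= K.+1)%N.
Proof. exact: (@size_lagrange_interp _ _ (fun j => v (i * K + j)%N)). Qed.

Lemma cell_fun_eq v i p : (size p <= K.+1)%N ->
  (forall j, (j <= K)%N -> v (i * K + j)%N = p.[g j]) -> cell_fun v i = p.
Proof.
move=> sp vp; apply: (gl_poly_eq K_gt0) => //; first exact: size_cell_fun.
by move=> j jK; rewrite cell_fun_node// vp.
Qed.

Lemma cell_basisE a i : cell_basis a i = cell_fun (fun b => (b == a)%:R) i.
Proof.
rewrite /cell_basis big_mkcond; apply: eq_bigr => j _.
by case: eqP => _; rewrite ?scale1r ?scale0r.
Qed.

Lemma cell_index_lt i j : (i < N)%N -> (j <= K)%N -> (i * K + j < (N * K).+1)%N.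
Proof.
move=> iN jK; rewrite ltnS (leq_trans (leq_add (leqnn _) jK))//.
by rewrite -mulSnr leq_mul2r iN orbT.
Qed.

Lemma cell_fun_expand v i : (i < N)%N ->
  \sum_(a < (N * K).+1) v a *: cell_basis a i = cell_fun v i.
Proof.
move=> iN; under eq_bigr do rewrite scaler_sumr.
rewrite (exchange_big_dep predT)//=; apply: eq_bigr => j _.
have jK : (j <= K)%N by rewrite -ltnS.
by rewrite (big_pred1 (Ordinal (cell_index_lt iN jK))).
Qed.

Lemma phiE a x : phi K N x0 dx a x =
  (cell_basis a (cell_of N x0 dx x)).[
    (cell_coord x0 dx (cell_of N x0 dx x)).[x]].
Proof. by rewrite /phi /cell_basis horner_sum cell_coordE. Qed.

Lemma phi_cell a i : (i < N)%N -> {in `]xb i, xb i.+1[, forall x,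
  phi K N x0 dx a x = (cell_basis a i).[(cell_coord x0 dx i).[x]]}.
Proof.
move=> iN x; rewrite in_itv/= => /andP[xi xi1].
by rewrite phiE (@cell_of_eq _ _ _ _ dx_gt0 i)// (ltW xi).
Qed.

Lemma derive1_phi a i : (i < N)%N -> {in `]xb i, xb i.+1[, forall x,
  derive1 (phi K N x0 dx a) x =
  (2 / dx *: (cell_basis a i)^`()).[(cell_coord x0 dx i).[x]]}.
Proof.
by move=> iN x xi; rewrite (derive1_cell xi (phi_cell _ iN)) hornerZ.
Qed.

Lemma cell_coord_node i j : (cell_coord x0 dx i).[cell_node K x0 dx i j] = g j.
Proof.
rewrite cell_coordE /cell_node; set b := cell_bound _ _ _.
by field; rewrite gt_eqF.
Qed.

Lemma cell_node0 i : cell_node K x0 dx i 0 = xb i.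
Proof. by rewrite /cell_node gl_node0// subrr mul0r mulr0 addr0. Qed.

Lemma cell_nodeK i : cell_node K x0 dx i K = xb i.+1.
Proof.
by rewrite /cell_node gl_nodeK// cell_boundS divff ?pnatr_eq0// mulr1.
Qed.

Lemma cell_node_itv i j : (j < K)%N -> xb i <= cell_node K x0 dx i j < xb i.+1.
Proof.
move=> jK; rewrite cell_boundS /cell_node lerDl ltrD2l.
have := gl_node_itv R K_gt0 (ltnW jK); rewrite in_itv/= => /andP[g1 g2].
have g3 : g j < 1.
  by rewrite lt_neqAle g2 andbT -(gl_nodeK R K_gt0) gl_node_inj ?(ltnW jK)// ltn_eqF.
rewrite mulr_ge0 ?(ltW dx_gt0)//=; last by lra.
by rewrite gtr_pMr//; lra.
Qed.

Lemma phi_cell_node a i j : (i < N)%N -> (j <= K)%N ->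
  phi K N x0 dx a (cell_node K x0 dx i j) = ((i * K + j)%N == a)%:R.
Proof.
have H k l : cell_of N x0 dx (cell_node K x0 dx k l) = k -> (l <= K)%N ->
    phi K N x0 dx a (cell_node K x0 dx k l) = ((k * K + l)%N == a)%:R.
  by move=> e lK; rewrite phiE e cell_coord_node cell_basisE cell_fun_node.
move=> iN jK; move: (jK); rewrite leq_eqVlt => /predU1P[->|jK']; last first.
  by apply: H => //; apply: (cell_of_eq dx_gt0) => //; exact: cell_node_itv.
(* An inner interface is attributed to the cell on its right, whose first point
   it is; only the right endpoint of omega stays in its own cell. *)
have [iN1|iN1] := ltnP i.+1 N.
  have -> : (i * K + K = i.+1 * K + 0)%N by lia.
  rewrite cell_nodeK -cell_node0; apply: H => //.
  by apply: (cell_of_eq dx_gt0) => //; exact: cell_node_itv.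
apply: H => //; rewrite cell_nodeK.
have -> : i.+1 = N by lia.
by rewrite cell_of_last//; lia.
Qed.

Lemma fe_fun_cell v (u : 'cV[R]_(N * K).+1) i : (forall a : 'I_(N * K).+1, u a 0 = v a) ->
  (i < N)%N -> {in `]xb i, xb i.+1[, forall x,
  fe_fun x0 dx u x = (cell_fun v i).[(cell_coord x0 dx i).[x]]}.
Proof.
move=> uv iN x xi; rewrite /fe_fun -cell_fun_expand// horner_sum.
by apply: eq_bigr => a _; rewrite uv (phi_cell _ iN)// hornerZ.
Qed.

Lemma fe_fun_node v (u : 'cV[R]_(N * K).+1) i j : (forall a : 'I_(N * K).+1, u a 0 = v a) ->
  (i < N)%N -> (j <= K)%N ->
  fe_fun x0 dx u (cell_node K x0 dx i j) = v (i * K + j)%N.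
Proof.
move=> uv iN jK; rewrite /fe_fun (bigD1 (Ordinal (cell_index_lt iN jK)))//=.
rewrite phi_cell_node// eqxx mulr1 uv big1 ?addr0// => a aij.
move: aij; rewrite -(inj_eq val_inj)/= eq_sym => /negPf aij.
by rewrite phi_cell_node// aij mulr0.
Qed.

End basis.

(** * The matrices *)

Lemma sum_two (R : nmodType) (F : nat -> R) n : (2 <= n)%N ->
  (forall i, (2 <= i)%N -> F i = 0) -> \sum_(i < n) F i = F 0%N + F 1%N.
Proof.
case: n => [|[|n]]// _ F0; rewrite !big_ord_recl big1 ?addr0// => i _.
exact: F0.
Qed.

Lemma mem_ker (R : realType) m n (A : 'M[R]_(m, n)) (u : 'cV[R]_n) :
  (u \in ker A) = (A *m u == 0).
Proof. by rewrite memv_ker lfunE. Qed.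

Lemma span_pair (R : fieldType) n (u v : 'cV[R]_n) (A : {vspace 'cV[R]_n}) :
  (<<[:: u; v]>> <= A)%VS = (u \in A) && (v \in A).
Proof.
by apply/span_subvP/andP => [H|[uA vA] z];
  [split; apply: H; rewrite !inE eqxx ?orbT|rewrite !inE => /orP[]/eqP->].
Qed.

Lemma mem_span_pair (R : fieldType) n (u v : 'cV[R]_n) (b c : R) :
  b *: u + c *: v \in <<[:: u; v]>>%VS.
Proof.
by rewrite rpredD// rpredZ// memv_span// !inE eqxx ?orbT.
Qed.

Section operators.
Variables (R : realType) (K N : nat) (x0 dx : R).
Hypotheses (K_gt0 : (0 < K)%N) (N_gt0 : (0 < N)%N) (dx_gt0 : 0 < dx).
Implicit Types (p q : {poly R}) (a b i j : nat) (x : R) (v t : nat -> R).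
Local Notation xb := (cell_bound x0 dx).
Local Notation g := (gl_node R K).
Local Notation L := (legendre R K).
Local Notation U := (cell_fun K).
Local Notation B := (cell_basis R K).
Local Notation NK := (N * K)%N.

Definition coef_vec v : 'cV[R]_(N * K).+1 := \col_a v a.

Lemma coef_vecE v (a : 'I_NK.+1) : coef_vec v a 0 = v a.
Proof. by rewrite mxE. Qed.

Lemma coef_vec_surj (u : 'cV[R]_(N * K).+1) : exists v, u = coef_vec v.
Proof.
exists (fun a => u (inord a) 0); apply/colP => a.
by rewrite mxE inord_val.
Qed.

Lemma coef_vec_lin v t c : coef_vec v + c *: coef_vec t = coef_vec (fun a => v a + c * t a).
Proof. by apply/colP => a; rewrite !mxE. Qed.

Lemma cell_fun_lin v t c i :
  U (fun a => v a + c * t a) i = U v i + c *: U t i.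
Proof.
rewrite /cell_fun scaler_sumr -big_split/=; apply: eq_bigr => j _.
by rewrite scalerDl scalerA.
Qed.

Lemma index_split a : (a <= NK)%N ->
  exists i j, [/\ (i < N)%N, (j <= K)%N & a = (i * K + j)%N].
Proof.
move=> aNK; have [aE|aE] := eqVneq a NK.
  exists N.-1, K; split => //; first by rewrite prednK.
  by rewrite aE -{1}(prednK N_gt0) mulSn addnC.
exists (a %/ K)%N, (a %% K)%N; split; last exact: divn_eq.
  by rewrite ltn_divLR// ltn_neqAle aE.
by rewrite ltnW// ltn_pmod.
Qed.

(** The coefficients of the function with pieces Q i. A point shared by two cells
    is read in the right one, hence the continuity hypothesis of glueE. *)
Definition glue (Q : nat -> {poly R}) a : R := (Q (a %/ K)%N).[g (a %% K)].

Lemma glueE Q i j : (forall k, (Q k).[1] = (Q k.+1).[-1]) -> (j <= K)%N ->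
  glue Q (i * K + j)%N = (Q i).[g j].
Proof.
move=> Qc; rewrite leq_eqVlt => /predU1P[->|jK].
  by rewrite /glue -mulSnr mulnK// modnMl gl_node0// gl_nodeK// Qc.
by rewrite /glue divnMDl// modnMDl divn_small// addn0 modn_small.
Qed.

Lemma cell_fun_glue Q i : (forall k, (Q k).[1] = (Q k.+1).[-1]) ->
  (size (Q i) <= K.+1)%N -> U (glue Q) i = Q i.
Proof. by move=> Qc sQ; apply: cell_fun_eq => // j jK; rewrite glueE. Qed.

(** Constant pieces agree from one cell to the next at the shared point. *)
Lemma cell_fun_const v : (forall i, (i < N)%N -> (U v i)^`() = 0) ->
  forall a, (a <= NK)%N -> v a = v 0%N.
Proof.
move=> U0.
have cst i j : (i < N)%N -> (j <= K)%N -> v (i * K + j)%N = v (i * K)%N.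
  move=> iN jK; rewrite -(cell_fun_node K_gt0 v i jK).
  rewrite -[in RHS](addn0 (i * K)%N) -(cell_fun_node K_gt0 v i (leq0n K)).
  by rewrite (deriv_eq0_const (U0 _ iN)) !hornerC.
have vi i : (i <= N)%N -> v (i * K)%N = v 0%N.
  elim: i => [//|i IHi] iN.
  by rewrite mulSnr cst// IHi// ltnW.
move=> a /index_split[i [j [iN jK ->]]].
by rewrite cst// vi// ltnW.
Qed.

(** Each derivation contributes a factor 2 / dx, the change of variables dx / 2. *)
Lemma mx_DxxE (a : 'I_NK.-1) (b : 'I_NK.+1) : mx_Dxx K N x0 dx a b =
  \sum_(i < N) 2 / dx * ref_int ((B a.+1 i)^`() * (B b i)^`()).
Proof.
rewrite mxE (@integral_omega_cells _ _ _ _ dx_gt0 _ (fun i =>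
  (2 / dx *: (B a.+1 i)^`()) * (2 / dx *: (B b i)^`()))); last first.
  by move=> i x iN xi; rewrite !(derive1_phi _ dx_gt0 _ iN xi) hornerM.
apply: eq_bigr => i _; rewrite ref_int_Zl ref_int_Zr.
by field; rewrite gt_eqF.
Qed.

(** The coefficient 1 gives the entries the common shape that sum_trial and
    sum_test rely on. *)
Lemma mx_DxE (a : 'I_NK.-1) (b : 'I_NK.+1) : mx_Dx K N x0 dx a b =
  \sum_(i < N) 1 * ref_int (B a.+1 i * (B b i)^`()).
Proof.
rewrite mxE (@integral_omega_cells _ _ _ _ dx_gt0 _ (fun i =>
  (B a.+1 i) * (2 / dx *: (B b i)^`()))); last first.
  by move=> i x iN xi; rewrite (derive1_phi _ dx_gt0 _ iN xi)
    (phi_cell _ dx_gt0 _ iN xi) hornerM.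
apply: eq_bigr => i _; rewrite ref_int_Zr.
by field; rewrite gt_eqF.
Qed.

Lemma mx_Dx_fullE (a b : 'I_NK.+1) : mx_Dx_full K N x0 dx a b =
  \sum_(i < N) 1 * ref_int (B a i * (B b i)^`()).
Proof.
rewrite mxE (@integral_omega_cells _ _ _ _ dx_gt0 _ (fun i =>
  (B a i) * (2 / dx *: (B b i)^`()))); last first.
  by move=> i x iN xi; rewrite (derive1_phi _ dx_gt0 _ iN xi)
    (phi_cell _ dx_gt0 _ iN xi) hornerM.
apply: eq_bigr => i _; rewrite ref_int_Zr.
by field; rewrite gt_eqF.
Qed.

Lemma mx_DtestE (a : 'I_NK.-1) (b : 'I_NK.+1) : mx_Dtest K N x0 dx a b =
  \sum_(i < N) 1 * ref_int ((B a.+1 i)^`() * B b i).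
Proof.
rewrite mxE (@integral_omega_cells _ _ _ _ dx_gt0 _ (fun i =>
  (2 / dx *: (B a.+1 i)^`()) * B b i)); last first.
  by move=> i x iN xi; rewrite (derive1_phi _ dx_gt0 _ iN xi)
    (phi_cell _ dx_gt0 _ iN xi) hornerM.
apply: eq_bigr => i _; rewrite ref_int_Zl.
by field; rewrite gt_eqF.
Qed.

(** D stands for the identity or for the derivation. *)
Lemma sum_trial (D : {linear {poly R} -> {poly R}}) (P : nat -> {poly R}) c v :
  \sum_(b < (N * K).+1) (\sum_(i < N) c * ref_int (P i * D (B b i))) * v b =
  \sum_(i < N) c * ref_int (P i * D (U v i)).
Proof.
under eq_bigr do rewrite mulr_suml.
rewrite exchange_big/=; apply: eq_bigr => i _.
rewrite -(cell_fun_expand _ _ (ltn_ord i)) linear_sum/= mulr_sumr ref_int_sum mulr_sumr.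
by apply: eq_bigr => b _; rewrite linearZ/= -scalerAr ref_int_Z; ring.
Qed.

(** The rows omit the first and last basis functions, which is harmless when t
    vanishes at both endpoints. *)
Lemma sum_test (D : {linear {poly R} -> {poly R}}) (Q : nat -> {poly R}) c t :
  t 0%N = 0 -> t NK = 0 ->
  \sum_(a < (N * K).-1) t a.+1 * (\sum_(i < N) c * ref_int (D (B a.+1 i) * Q i)) =
  \sum_(i < N) c * ref_int (D (U t i) * Q i).
Proof.
move=> t0 tN.
pose F a := t a * (\sum_(i < N) c * ref_int (D (B a i) * Q i)).
have -> : \sum_(a < (N * K).-1) t a.+1 *
    (\sum_(i < N) c * ref_int (D (B a.+1 i) * Q i)) = \sum_(a < NK.+1) F a.
  have NK0 : (0 < NK)%N by rewrite muln_gt0 N_gt0.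
  have FN : F NK = 0 by rewrite /F tN mul0r.
  rewrite -/(F _); under eq_bigr do rewrite -/(F _).
  rewrite -(big_mkord predT (fun a => F a.+1)) -(big_mkord predT F).
  rewrite [RHS]big_nat_recr// FN -{2}(prednK NK0) [in RHS]big_nat_recl//=.
  by rewrite [in RHS]/F t0 mul0r add0r addr0.
rewrite /F; under eq_bigr do rewrite mulr_sumr.
rewrite exchange_big/=; apply: eq_bigr => i _.
rewrite -(cell_fun_expand _ _ (ltn_ord i)) linear_sum/= mulr_suml ref_int_sum mulr_sumr.
by apply: eq_bigr => b _; rewrite linearZ/= -scalerAl ref_int_Z; ring.
Qed.

Lemma mulDxx v (a : 'I_NK.-1) : (mx_Dxx K N x0 dx *m coef_vec v) a 0 =
  \sum_(i < N) 2 / dx * ref_int ((B a.+1 i)^`() * (U v i)^`()).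
Proof.
rewrite mxE; under eq_bigr do rewrite mx_DxxE coef_vecE.
exact: (sum_trial _ (fun i => (B a.+1 i)^`())).
Qed.

Lemma mulDx v (a : 'I_NK.-1) : (mx_Dx K N x0 dx *m coef_vec v) a 0 =
  \sum_(i < N) 1 * ref_int (B a.+1 i * (U v i)^`()).
Proof.
rewrite mxE; under eq_bigr do rewrite mx_DxE coef_vecE.
exact: (sum_trial _ (fun i => B a.+1 i)).
Qed.

Lemma mulDx_full v (a : 'I_NK.+1) : (mx_Dx_full K N x0 dx *m coef_vec v) a 0 =
  \sum_(i < N) 1 * ref_int (B a i * (U v i)^`()).
Proof.
rewrite mxE; under eq_bigr do rewrite mx_Dx_fullE coef_vecE.
exact: (sum_trial _ (fun i => B a i)).
Qed.

Lemma mulDtest v (a : 'I_NK.-1) : (mx_Dtest K N x0 dx *m coef_vec v) a 0 =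
  \sum_(i < N) 1 * ref_int ((B a.+1 i)^`() * U v i).
Proof.
rewrite mxE; under eq_bigr do rewrite mx_DtestE coef_vecE.
exact: (sum_trial idfun (fun i => (B a.+1 i)^`())).
Qed.

Lemma testDxx v t : t 0%N = 0 -> t NK = 0 ->
  \sum_(a < (N * K).-1) t a.+1 * (mx_Dxx K N x0 dx *m coef_vec v) a 0 =
  \sum_(i < N) 2 / dx * ref_int ((U t i)^`() * (U v i)^`()).
Proof.
move=> t0 tN; under eq_bigr do rewrite mulDxx.
exact: (sum_test _ (fun i => (U v i)^`())).
Qed.

Lemma testDx v t : t 0%N = 0 -> t NK = 0 ->
  \sum_(a < (N * K).-1) t a.+1 * (mx_Dx K N x0 dx *m coef_vec v) a 0 =
  \sum_(i < N) 1 * ref_int (U t i * (U v i)^`()).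
Proof.
move=> t0 tN; under eq_bigr do rewrite mulDx.
exact: (sum_test idfun (fun i => (U v i)^`())).
Qed.

Lemma testDtest v t : t 0%N = 0 -> t NK = 0 ->
  \sum_(a < (N * K).-1) t a.+1 * (mx_Dtest K N x0 dx *m coef_vec v) a 0 =
  \sum_(i < N) 1 * ref_int ((U t i)^`() * U v i).
Proof.
move=> t0 tN; under eq_bigr do rewrite mulDtest.
exact: (sum_test _ (fun i => U v i)).
Qed.

Definition nodal_mass a : R :=
  \sum_(i < N) \sum_(j < K.+1 | (i * K + j)%N == a) dx / 2 * gl_weight R K j.

Lemma gl_weight_gt0 j : (j <= K)%N -> 0 < gl_weight R K j.
Proof. by move=> jK; rewrite gl_weightE ref_int_lagrange_gt0. Qed.

(** An interface gets the sum of two weights, all of them positive. *)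
Lemma nodal_mass_gt0 a : (a <= NK)%N -> 0 < nodal_mass a.
Proof.
have w_gt0 (j : 'I_K.+1) : 0 < dx / 2 * gl_weight R K j.
  by rewrite mulr_gt0 ?divr_gt0// gl_weight_gt0// -ltnS.
move=> /index_split[i [j [iN]]]; rewrite -ltnS => jK ->.
rewrite /nodal_mass (bigD1 (Ordinal iN))//= (bigD1 (Ordinal jK))//= ltr_pwDl//.
  by rewrite (ltr_pwDl (w_gt0 (Ordinal jK)))//; apply: sumr_ge0 => k _; rewrite ltW.
by apply: sumr_ge0 => k _; apply: sumr_ge0 => l _; rewrite ltW.
Qed.

Lemma nodal_mass0 : nodal_mass 0 = dx / 2 * gl_weight R K 0.
Proof.
rewrite /nodal_mass (bigD1 (Ordinal N_gt0))//= (bigD1 ord0)//=.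
rewrite big1 ?addr0; last first.
  by move=> j; rewrite mul0n add0n => /andP[/eqP j0]; rewrite -(inj_eq val_inj)/= j0.
rewrite big1 ?addr0// => i; rewrite -(inj_eq val_inj)/= => i0.
rewrite big_pred0// => j; apply/negbTE.
by rewrite addn_eq0 muln_eq0 (negPf i0)/= gtn_eqF.
Qed.

Lemma nodal_massN : nodal_mass NK = dx / 2 * gl_weight R K K.
Proof.
have N1 : (N.-1 < N)%N by rewrite prednK.
rewrite /nodal_mass (bigD1 (Ordinal N1))//= (bigD1 ord_max)/=; last first.
  by rewrite -mulSnr prednK.
have e : NK = (N.-1 * K + K)%N by rewrite -mulSnr prednK.
rewrite big1 ?addr0; last first.
  move=> j; rewrite e eqn_add2l => /andP[/eqP jK]; rewrite -(inj_eq val_inj)/= jK.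
  by rewrite eqxx.
rewrite big1 ?addr0// => i; rewrite -(inj_eq val_inj)/= => iN.
rewrite big_pred0// => j; apply/negbTE; rewrite neq_ltn; apply/orP; left.
have := ltn_ord i; have := ltn_ord j; rewrite ltnS e => jK iN'.
have : (i.+1 <= N.-1)%N by lia.
by rewrite -(leq_pmul2r K_gt0) mulSnr => ?; lia.
Qed.

(** At the quadrature points the basis functions are 0 or 1. *)
Lemma mx_massE : mx_mass K N x0 dx = diag_mx (\row_a nodal_mass a).
Proof.
apply/matrixP => a b; rewrite !mxE /gl_quad.
have -> : \sum_(i < N) \sum_(j < K.+1) dx / 2 * gl_weight R K j *
    (phi K N x0 dx a (cell_node K x0 dx i j) *
     phi K N x0 dx b (cell_node K x0 dx i j)) =
  \sum_(i < N) \sum_(j < K.+1 | (i * K + j)%N == a)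
    dx / 2 * gl_weight R K j *+ (a == b).
  apply: eq_bigr => i _; rewrite [RHS]big_mkcond; apply: eq_bigr => j _.
  have jK : (j <= K)%N by rewrite -ltnS.
  rewrite !(phi_cell_node _ K_gt0 dx_gt0)//; case: (eqVneq _ (a : nat)) => [->|_].
    by rewrite mul1r mulr_natr (inj_eq val_inj).
  by rewrite mul0r mulr0.
by rewrite /nodal_mass -sumrMnl; apply: eq_bigr => i _; rewrite sumrMnl.
Qed.

Lemma mul_mass v : mx_mass K N x0 dx *m coef_vec v = coef_vec (fun a => nodal_mass a * v a).
Proof.
by rewrite mx_massE mul_diag_mx; apply/colP => a; rewrite !mxE.
Qed.

Lemma mass_unit : mx_mass K N x0 dx \in unitmx.
Proof.
rewrite mx_massE unitmxE det_diag unitfE; apply/prodf_neq0 => a _.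
by rewrite mxE gt_eqF// nodal_mass_gt0// -ltnS.
Qed.

(** Once D_x v is written M y, the inverse of M is eliminated. *)
Lemma mulZx v y : mx_Dx_full K N x0 dx *m coef_vec v = mx_mass K N x0 dx *m coef_vec y ->
  mx_Zx K N x0 dx *m coef_vec v =
  mx_Dxx K N x0 dx *m coef_vec v - mx_Dtest K N x0 dx *m coef_vec y.
Proof.
by move=> e; rewrite /mx_Zx mulmxBl -!mulmxA e mulKmx// mass_unit.
Qed.

Lemma basis_right a i : (B a i).[1] = ((i.+1 * K)%N == a)%:R.
Proof.
by rewrite cell_basisE -(gl_nodeK R K_gt0) cell_fun_node// mulSnr.
Qed.

Lemma basis_left a i : (B a i).[-1] = ((i * K)%N == a)%:R.
Proof.
by rewrite cell_basisE -(gl_node0 R K_gt0) cell_fun_node// addn0.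
Qed.

(** The sum telescopes since s^2 = 1: both sides of an interface cancel. With
    s = 1 it is the integral of the derivative of a basis function; s = (-1)^K
    is the case of the function w. *)
Lemma sum_basis_jumps s a : s ^+ 2 = 1 ->
  \sum_(i < N) s ^+ i * ((B a i).[1] - s * (B a i).[-1]) =
  s ^+ N.+1 * (NK == a)%:R - s * (0%N == a)%:R.
Proof.
move=> s2; under eq_bigr do rewrite basis_right basis_left.
elim: N => [|n IHn]; first by rewrite big_ord0 expr1 mul0n subrr.
by rewrite big_ord_recr/= IHn !exprS; ring: s2.
Qed.

(** * The constant and coordinate functions *)

Definition cell_pos i : {poly R} := (xb i)%:P + (dx / 2) *: (1 + 'X).

Lemma cell_pos_cont k : (cell_pos k).[1] = (cell_pos k.+1).[-1].
Proof. by rewrite /cell_pos !hornerE/= cell_boundS; field. Qed.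

Lemma size_cell_pos i : (size (cell_pos i) <= K.+1)%N.
Proof.
have : (size (cell_pos i) <= 2)%N.
  rewrite /cell_pos (leq_trans (size_polyD _ _))// geq_max.
  rewrite (leq_trans (size_polyC_leq1 _))//=.
  rewrite (leq_trans (size_scale_leq _ _))// (leq_trans (size_polyD _ _))//.
  by rewrite size_poly1 size_polyX.
by move=> /leq_trans; apply.
Qed.

Lemma deriv_cell_pos i : (cell_pos i)^`() = (dx / 2)%:P.
Proof.
by rewrite /cell_pos derivD derivC derivZ -polyC1 derivD derivC derivX !add0r alg_polyC.
Qed.

Lemma node_glue a : node K x0 dx a = glue cell_pos a.
Proof.
by rewrite /node /glue /cell_pos /cell_node !hornerE/=; field.
Qed.

Lemma cell_fun_pos i : U (node K x0 dx) i = cell_pos i.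
Proof.
rewrite -(cell_fun_glue cell_pos_cont (size_cell_pos i)); apply: eq_bigr => j _.
by rewrite node_glue.
Qed.

Lemma cell_fun_one i : U (fun=> 1) i = 1 :> {poly R}.
Proof.
by apply: cell_fun_eq => //; rewrite ?size_poly1// => j jK; rewrite hornerC.
Qed.

Lemma sum_test_derivative c (a : 'I_NK.-1) :
  \sum_(i < N) c * ref_int ((B a.+1 i)^`() * 1) = 0.
Proof.
under eq_bigr do rewrite mulr1 ref_int_deriv.
have := sum_basis_jumps a.+1 (expr1n R 2); rewrite -mulr_sumr.
under eq_bigr do rewrite expr1n !mul1r.
by move=> ->; rewrite expr1n !mul1r gtn_eqF ?subrr ?mulr0//; have := ltn_ord a; lia.
Qed.

Lemma mulDxx_one : mx_Dxx K N x0 dx *m coef_vec (fun=> 1) = 0.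
Proof.
apply/colP => a; rewrite mulDxx mxE big1// => i _.
by rewrite cell_fun_one -polyC1 derivC mulr0 ref_int_0 mulr0.
Qed.

Lemma mulDxx_pos : mx_Dxx K N x0 dx *m coef_vec (node K x0 dx) = 0.
Proof.
apply/colP => a; rewrite mulDxx mxE.
under eq_bigr do rewrite cell_fun_pos deriv_cell_pos -[_%:P]mulr1 mul_polyC ref_int_Zr mulrA.
exact: sum_test_derivative.
Qed.

Lemma mulDtest_one : mx_Dtest K N x0 dx *m coef_vec (fun=> 1) = 0.
Proof.
apply/colP => a; rewrite mulDtest mxE.
under eq_bigr do rewrite cell_fun_one.
exact: sum_test_derivative.
Qed.

Lemma mulDx_full_one : mx_Dx_full K N x0 dx *m coef_vec (fun=> 1) = 0.
Proof.
apply/colP => a; rewrite mulDx_full mxE big1// => i _.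
by rewrite cell_fun_one -polyC1 derivC mulr0 ref_int_0 mulr0.
Qed.

(** Both sides are the integrals of the basis functions, the quadrature weights
    being the integrals of the Lagrange polynomials. Thus M^-1 D_x x = 1, and
    the two terms of Z_x x vanish separately. *)
Lemma mulDx_full_pos : mx_Dx_full K N x0 dx *m coef_vec (node K x0 dx) =
  mx_mass K N x0 dx *m coef_vec (fun=> 1).
Proof.
rewrite mul_mass; apply/colP => a; rewrite mulDx_full mxE mulr1.
apply: eq_bigr => i _; rewrite mul1r cell_fun_pos deriv_cell_pos mulrC mul_polyC.
rewrite ref_int_Z /cell_basis ref_int_sum mulr_sumr.
by apply: eq_bigr => j _; rewrite gl_weightE.
Qed.

Lemma mulZx_one : mx_Zx K N x0 dx *m coef_vec (fun=> 1) = 0.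
Proof.
rewrite (@mulZx _ (fun=> 0)); last first.
  rewrite mul_mass mulDx_full_one; apply/colP => a; by rewrite !mxE mulr0.
rewrite mulDxx_one sub0r; apply/colP => a; rewrite mxE mulDtest big1 ?oppr0 ?mxE// => i _.
by rewrite /cell_fun big1 ?mulr0 ?ref_int_0 ?mulr0// => j _; rewrite scale0r.
Qed.

Lemma mulZx_pos : mx_Zx K N x0 dx *m coef_vec (node K x0 dx) = 0.
Proof. by rewrite (mulZx mulDx_full_pos) mulDxx_pos mulDtest_one subrr. Qed.

(** Minus the affine function with the same values at both endpoints, an element
    of the kernel is an admissible test function; testing it against itself
    shows that its derivative vanishes. *)
Lemma ker_Dxx v : mx_Dxx K N x0 dx *m coef_vec v = 0 ->
  exists c d, coef_vec v = c *: coef_vec (fun=> 1) + d *: coef_vec (node K x0 dx).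
Proof.
move=> Dv.
(* d and c are the slope and intercept of that affine function. *)
pose d := (v NK - v 0%N) / (N%:R * dx); pose c := v 0%N - d * xb 0.
pose t a := (v a + (- c) * 1) + (- d) * node K x0 dx a.
have node0 : node K x0 dx 0 = xb 0 by rewrite /node div0n mod0n cell_node0.
have nodeN : node K x0 dx NK = xb N by rewrite /node mulnK// modnMl cell_node0.
have t0 : t 0%N = 0 by rewrite /t node0 /c; ring.
have tN : t NK = 0.
  rewrite /t nodeN /c /d /cell_bound; field.
  by rewrite gt_eqF//= pnatr_eq0 -lt0n.
have Dt : mx_Dxx K N x0 dx *m coef_vec t = 0.
  rewrite -coef_vec_lin -(coef_vec_lin v (fun=> 1)) !mulmxDr -!scalemxAr.
  by rewrite Dv mulDxx_one mulDxx_pos !scaler0 !addr0.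
have t_cst a : (a <= NK)%N -> t a = 0.
  move=> aNK; rewrite -[RHS]t0; apply: cell_fun_const a aNK => i iN.
  apply/eqP/negPn/negP => Ui0.
  have sq_ge0 p : {in `[-1, 1], forall x, 0 <= (p * p).[x]}.
    by move=> x _; rewrite hornerM -expr2 sqr_ge0.
  have ref_int_sq p : 0 <= ref_int (p * p).
    have [->|p0] := eqVneq p 0; first by rewrite mulr0 ref_int_0.
    by apply/ltW/ref_int_gt0 => //; rewrite mulf_neq0.
  have := testDxx t t0 tN; rewrite Dt big1; last by move=> a' _; rewrite mxE mulr0.
  move/esym/eqP; rewrite psumr_eq0; last first.
    by move=> k _; rewrite mulr_ge0// divr_ge0// ltW.
  move=> /allP/(_ (Ordinal iN)); rewrite mem_index_enum => /(_ isT)/=.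
  rewrite gt_eqF// mulr_gt0 ?divr_gt0//; apply: ref_int_gt0 => //.
  by rewrite mulf_neq0.
exists c, d; apply/colP => a; rewrite !mxE.
have := t_cst a; rewrite -ltnS ltn_ord /t => /(_ isT) e.
by apply/eqP; rewrite -subr_eq0 -e; apply/eqP; ring.
Qed.

(** * The kernel of D_x *)

Local Notation s := ((-1) ^+ K : R).
Local Notation lam := (L.[1]).

(** The pieces of w. The signs make them match at the interfaces, because
    L(-1) = (-1)^K L(1). *)
Definition cell_w i : {poly R} := s ^+ i *: L.

Lemma horner_cell_w i x : (cell_w i).[x] = s ^+ i * L.[x].
Proof. exact: hornerZ. Qed.

Lemma cell_w_cont k : (cell_w k).[1] = (cell_w k.+1).[-1].
Proof.
by rewrite !horner_cell_w legendre_m1 exprSr -mulrA (mulrA s) -expr2 sqrr_sign mul1r.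
Qed.

Lemma cell_fun_w i : U (glue cell_w) i = cell_w i.
Proof.
apply: (cell_fun_glue cell_w_cont).
by rewrite (leq_trans (size_scale_leq _ _))// size_legendre.
Qed.

(** After integration by parts, the remaining integral is zero because p' is
    orthogonal to L. *)
Lemma ref_int_deriv_legendre p : (size p <= K.+1)%N ->
  ref_int (p * L^`()) = lam * (p.[1] - s * p.[-1]).
Proof.
move=> sp; rewrite ref_int_parts legendre_orthogonal; last first.
  by rewrite size_deriv; case: (size p) sp.
by rewrite legendre_m1; ring.
Qed.

Lemma size_basis a i : (size (B a i) <= K.+1)%N.
Proof. by rewrite cell_basisE size_cell_fun. Qed.

Lemma sum_legendre_rows (c : nat -> R) v a :
  (forall i, (i < N)%N -> (U v i)^`() = c i *: L^`()) ->
  \sum_(i < N) 1 * ref_int (B a i * (U v i)^`()) =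
  lam * \sum_(i < N) c i * ((B a i).[1] - s * (B a i).[-1]).
Proof.
move=> Uv; rewrite mulr_sumr; apply: eq_bigr => i _.
rewrite mul1r Uv// ref_int_Zr ref_int_deriv_legendre ?size_basis//; ring.
Qed.

Lemma deriv_cell_w i : (cell_w i)^`() = s ^+ i *: L^`().
Proof. by rewrite derivZ. Qed.

Lemma mulDx_full_w : mx_Dx_full K N x0 dx *m coef_vec (glue cell_w) =
  coef_vec (fun a => lam * (s ^+ N.+1 * (NK == a)%:R - s * (0%N == a)%:R)).
Proof.
apply/colP => a; rewrite mulDx_full mxE (sum_legendre_rows (c := fun i => s ^+ i)).
  by rewrite sum_basis_jumps// sqrr_sign.
by move=> i iN; rewrite cell_fun_w deriv_cell_w.
Qed.

Lemma mulDx_w : mx_Dx K N x0 dx *m coef_vec (glue cell_w) = 0.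
Proof.
apply/colP => a; rewrite mulDx mxE (sum_legendre_rows (c := fun i => s ^+ i)).
  rewrite sum_basis_jumps ?sqrr_sign// gtn_eqF; last by have := ltn_ord a; lia.
  by rewrite !mulr0 subrr mulr0.
by move=> i iN; rewrite cell_fun_w deriv_cell_w.
Qed.

Lemma mulDx_one : mx_Dx K N x0 dx *m coef_vec (fun=> 1) = 0.
Proof.
apply/colP => a; rewrite mulDx mxE big1// => i _.
by rewrite cell_fun_one -polyC1 derivC mulr0 ref_int_0 mulr0.
Qed.

(** The scalar c for which c L' and p' have the same coefficient of degree K - 1. *)
Definition legendre_slope p : R := p^`()`_K.-1 / L^`()`_K.-1.

(** The difference r between the derivative and that multiple of L' has degree at
    most K - 2, so that (1 - X^2) r, extended by zero outside the cell, is a test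
    function. As L' is orthogonal to such bubbles, what remains of the test is the
    integral of (1 - X^2) r^2, which must vanish. *)
Lemma ker_Dx_deriv_cell_fun v i : mx_Dx K N x0 dx *m coef_vec v = 0 -> (i < N)%N ->
  (U v i)^`() = legendre_slope (U v i) *: L^`().
Proof.
move=> Dv iN; set c := legendre_slope _; pose r := (U v i)^`() - c *: L^`().
suff : r = 0 by move/eqP; rewrite subr_eq0 => /eqP.
have sr : (size r < K)%N.
  apply: (@leq_ltn_trans K.-1); last by rewrite prednK.
  apply/leq_sizeP => j; rewrite leq_eqVlt => /predU1P[<-|jK].
    rewrite coefB coefZ /c /legendre_slope divfK ?subrr//.
    rewrite -[K in _`_K.-1](size_deriv_legendre R K) -/(lead_coef _).
    by rewrite lead_coef_eq0 deriv_legendre_neq0.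
  have /leq_sizeP -> // : (size r <= K)%N; last by rewrite -(prednK K_gt0).
  rewrite (leq_trans (size_polyD _ _))// geq_max size_polyN.
  rewrite (leq_trans (size_scale_leq _ _)) ?size_deriv_legendre// andbT.
  by rewrite size_deriv; have := size_cell_fun K v i; case: (size _).
pose b : {poly R} := (1 - 'X^2) * r.
have bE : b = - (('X^2 - 1) * r) by rewrite /b; ring.
have sb : (size b <= K.+1)%N.
  rewrite bE size_polyN; have := size_polyMleq ('X^2 - 1) r.
  by rewrite size_X21; move: (size _) (size r) sr => m n; lia.
have b1 : b.[1] = 0 by rewrite bE hornerN hornerM X21_root mul0r oppr0.
have bm1 : b.[-1] = 0 by rewrite bE hornerN hornerM X21_root mul0r oppr0.
pose Q k : {poly R} := if k == i then b else 0.
have Qc k : (Q k).[1] = (Q k.+1).[-1].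
  by rewrite /Q; case: eqP => _; case: eqP => _; rewrite ?b1 ?bm1 ?horner0.
have UQ k : U (glue Q) k = Q k.
  by apply: cell_fun_glue => //; rewrite /Q; case: eqP => _; rewrite ?size_poly0.
have Q0 : glue Q 0 = 0.
  by rewrite /glue div0n mod0n gl_node0// /Q; case: eqP => _; rewrite ?bm1 ?horner0.
have QN : glue Q NK = 0.
  rewrite /glue mulnK// modnMl gl_node0// /Q.
  by case: eqP => _; rewrite ?bm1 ?horner0.
have := testDx v Q0 QN; rewrite Dv big1; last by move=> a _; rewrite mxE mulr0.
rewrite (bigD1 (Ordinal iN))//= big1 ?addr0; last first.
  move=> k; rewrite -(inj_eq val_inj)/= => /negPf ki.
  by rewrite UQ /Q ki mul0r ref_int_0 mulr0.
rewrite mul1r UQ /Q eqxx.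
have -> : (U v i)^`() = r + c *: L^`() by rewrite /r subrK.
rewrite mulrDr ref_int_D ref_int_Zr.
have -> : ref_int (b * L^`()) = 0.
  rewrite bE mulNr -scaleN1r ref_int_Z mulrAC ref_int_bubble ?mulr0//.
rewrite mulr0 addr0 => /esym/eqP; apply: contraTeq => r0; rewrite gt_eqF//.
apply: ref_int_gt0.
  move=> x; rewrite in_itv/= => /andP[x1 x2].
  rewrite /b -mulrA hornerM mulr_ge0//.
    by rewrite !hornerE subr_ge0 expr2; nra.
  by rewrite hornerM -expr2 sqr_ge0.
by rewrite !mulf_neq0// -opprB oppr_eq0 X21_neq0.
Qed.

(** By ker_Dx_deriv_cell_fun the derivative is a multiple c i of L' on cell i, and
    the row of an interface gives c (i + 1) = (-1)^K c i. So the derivative is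
    proportional to that of w. *)
Lemma ker_Dx v : mx_Dx K N x0 dx *m coef_vec v = 0 ->
  exists c d, coef_vec v = c *: coef_vec (fun=> 1) + d *: coef_vec (glue cell_w).
Proof.
move=> Dv; pose c i := legendre_slope (U v i).
have Uv i : (i < N)%N -> (U v i)^`() = c i *: L^`() by exact: ker_Dx_deriv_cell_fun.
have cS i : (i.+1 < N)%N -> c i.+1 = s * c i.
  move=> iN.
  have aP : ((i.+1 * K).-1 < NK.-1)%N.
    have : (i.+1 * K < N * K)%N by rewrite ltn_pmul2r.
    by rewrite mulSn; lia.
  have := mulDx v (Ordinal aP); rewrite Dv mxE/= (sum_legendre_rows _ Uv) prednK; last first.
    by rewrite muln_gt0.
  move/esym/eqP; rewrite mulf_eq0 (negPf (legendre1_neq0 _ _))/=.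
  under eq_bigr do rewrite basis_right basis_left !eqn_pmul2r// eqSS.
  have iN' : (i < N)%N by exact: ltnW.
  rewrite (bigD1 (Ordinal iN'))//= (bigD1 (Ordinal iN))/=; last first.
    by rewrite -(inj_eq val_inj)/= gtn_eqF.
  rewrite big1 ?addr0; last first.
    move=> k /andP[]; rewrite -!(inj_eq val_inj)/= => /negPf -> /negPf ->.
    by rewrite mulr0 subrr mulr0.
  rewrite !eqxx ltn_eqF// gtn_eqF// mulr0 subr0 mulr1 sub0r mulr1 mulrN subr_eq0.
  by move=> /eqP ->; rewrite mulrCA -expr2 sqrr_sign mulr1.
have cE i : (i < N)%N -> c i = c 0%N * s ^+ i.
  elim: i => [_|i IHi iN]; first by rewrite expr0 mulr1.
  by rewrite cS// IHi ?exprS 1?ltnW//; ring.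
pose t a := v a + (- c 0%N) * glue cell_w a.
have t_cst a : (a <= NK)%N -> t a = t 0%N.
  move=> aNK; apply: cell_fun_const a aNK => i iN.
  rewrite cell_fun_lin derivD derivZ cell_fun_w deriv_cell_w Uv// cE// scalerA.
  by rewrite -scalerDl mulNr subrr scale0r.
exists (t 0%N), (c 0%N); apply/colP => a; rewrite !mxE mulr1.
have := t_cst a; rewrite -ltnS ltn_ord => <-//.
by rewrite /t mulNr subrK.
Qed.

(** The slopes on both sides of an interface are opposite, and L'(1) is not zero. *)
Lemma w_jump i : (0 < i < N)%N ->
  derivative_jump (fe_fun x0 dx (coef_vec (glue cell_w))) (xb i).
Proof.
case: i => // i /= iN.
have Uw k : (k < N)%N -> {in `]xb k, xb k.+1[, forall x,
    derive1 (fe_fun x0 dx (coef_vec (glue cell_w))) x =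
    (2 / dx *: ((cell_w k)^`() \Po cell_coord x0 dx k)).[x]}.
  move=> kN x xk; rewrite (derive1_cell xk
    (@fe_fun_cell _ _ _ _ _ dx_gt0 (glue cell_w) _ k _ kN)).
    by rewrite cell_fun_w hornerZ horner_comp.
  by move=> a; rewrite mxE.
pose l := (2 / dx *: ((cell_w i)^`() \Po cell_coord x0 dx i)).[xb i.+1].
pose r := (2 / dx *: ((cell_w i.+1)^`() \Po cell_coord x0 dx i.+1)).[xb i.+1].
exists l, r; split.
- rewrite /l; set P := _ *: _; apply: (@cvg_trans _ (P.[y] @[y --> (xb i.+1)^'-])); last first.
    exact/cvg_at_left_filter/continuous_horner.
  apply: near_eq_cvg; near=> y; rewrite (Uw _ (ltnW iN))//.
  rewrite in_itv/=; apply/andP; split; near: y; last exact: nbhs_left_lt.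
  exact/nbhs_left_gt/cell_bound_lt.
- rewrite /r; set P := _ *: _; apply: (@cvg_trans _ (P.[y] @[y --> (xb i.+1)^'+])); last first.
    exact/cvg_at_right_filter/continuous_horner.
  apply: near_eq_cvg; near=> y; rewrite (Uw _ iN)//.
  rewrite in_itv/=; apply/andP; split; near: y; first exact: nbhs_right_gt.
  exact/nbhs_right_lt/cell_bound_lt.
- rewrite /l /r !hornerZ !horner_comp cell_coord_right// cell_coord_left.
  rewrite !deriv_cell_w !hornerZ deriv_legendre_m1.
  have -> : s ^+ i.+1 * - (s * L^`().[1]) = - (s ^+ i * L^`().[1]).
    by rewrite exprSr mulrN -mulrA (mulrA s) -expr2 sqrr_sign mul1r.
  rewrite mulrN eq_sym -subr_eq0 -opprD oppr_eq0 -mulr2n mulrn_eq0/=.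
  rewrite mulf_neq0//; first by rewrite gt_eqF// divr_gt0.
  by rewrite mulf_neq0 ?expf_neq0 ?signr_eq0 ?deriv_legendre1_neq0.
Unshelve. all: by end_near. Qed.

(** Otherwise L, which has degree K >= 1, would take the same value at K + 1
    nodes. *)
Lemma w_nonconstant : ~ constant_on (omega N x0 dx) (fe_fun x0 dx (coef_vec (glue cell_w))).
Proof.
move=> [c wc].
have := size_legendre R K; suff -> : L = c%:P.
  by rewrite size_polyC; case: K K_gt0 => // k _; case: (c != 0).
apply: (gl_poly_eq K_gt0); rewrite ?size_legendre//.
  by rewrite (leq_trans (size_polyC_leq1 _)).
move=> j jK.
rewrite hornerC -[RHS](wc (cell_node K x0 dx 0 j)).
  rewrite (@fe_fun_node _ _ _ _ _ K_gt0 dx_gt0 (glue cell_w))//; last first.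
    by move=> a; rewrite mxE.
  by rewrite (glueE _ cell_w_cont)// /cell_w expr0 scale1r.
rewrite /omega/= in_itv/=.
have xb0 i : xb 0 <= xb i.
  by rewrite /cell_bound mul0r addr0 lerDl mulr_ge0// ltW.
have xb1 : xb 1 <= xb N.
  by rewrite /cell_bound lerD2l ler_pM2r// ler_nat.
move: jK; rewrite leq_eqVlt => /predU1P[->|jK]; first by rewrite cell_nodeK// xb0.
have /andP[-> j1] := cell_node_itv x0 K_gt0 dx_gt0 0 jK.
exact/ltW/(lt_le_trans j1).
Qed.

(** * The action of Z_x on w *)

(** By mulDx_full_w, the vector y = M^-1 D_x w is supported at the two endpoints of
    omega. Tested with the hat function of the first interface, Z_x w therefore
    gives (L(1) / dx) (2 - s + s [N = 2]) where s = (-1)^K, and this is not zero.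
    The Iverson bracket is there because the right endpoint of omega is in the
    support of the hat only when there are two cells. *)
Lemma mulZx_w_neq0 : (2 <= N)%N -> mx_Zx K N x0 dx *m coef_vec (glue cell_w) != 0.
Proof.
move=> N2.
pose z a : R := lam * (s ^+ N.+1 * (NK == a)%:R - s * (0%N == a)%:R).
pose y a : R := z a / nodal_mass a.
rewrite (@mulZx _ y); last first.
  rewrite mulDx_full_w mul_mass; apply/colP => a; rewrite !mxE /y mulrCA.
  by rewrite divff ?mulr1// gt_eqF// nodal_mass_gt0// -ltnS.
(* The pieces of the hat function. *)
pose Q (k : nat) : {poly R} :=
  if k is k'.+1 then if k' is _.+1 then 0 else 2^-1 *: (1 - 'X) else 2^-1 *: (1 + 'X).
have Qc k : (Q k).[1] = (Q k.+1).[-1].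
  by case: k => [|[|k]] /=;
    rewrite ?hornerZ ?hornerD ?hornerN ?hornerX ?hornerC ?horner0; field.
have sQ k : (size (Q k) <= K.+1)%N.
  apply: (@leq_trans 2) => //.
  by case: k => [|[|k]]; rewrite /Q ?size_poly0// (leq_trans (size_scale_leq _ _))//
    (leq_trans (size_polyD _ _))// ?size_polyN size_poly1 size_polyX.
have UQ k : U (glue Q) k = Q k by exact: cell_fun_glue.
have Q0 : glue Q 0 = 0.
  by rewrite /glue div0n mod0n gl_node0//= hornerZ hornerD hornerX hornerC subrr mulr0.
have QN : glue Q NK = 0.
  rewrite /glue mulnK// modnMl gl_node0//.
  by case: N N2 => [|[|k]]//= _; rewrite horner0.
apply/eqP => /eqP; rewrite subr_eq0 => /eqP Zw0.
have := testDtest y Q0 QN; rewrite -Zw0 testDxx//.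
rewrite (@sum_two _ (fun i => 2 / dx *
  ref_int ((U (glue Q) i)^`() * (U (glue cell_w) i)^`())))//; last first.
  by move=> [|[|k]]// _; rewrite UQ derivC mul0r ref_int_0 mulr0.
rewrite (@sum_two _ (fun i => 1 * ref_int ((U (glue Q) i)^`() * U y i)))//; last first.
  by move=> [|[|k]]// _; rewrite UQ derivC mul0r ref_int_0 mulr0.
have dQ0 : (Q 0%N)^`() = 2^-1%:P.
  by rewrite /= derivZ derivD derivX -polyC1 derivC add0r alg_polyC.
have dQ1 : (Q 1%N)^`() = (- 2^-1)%:P.
  by rewrite /= derivZ derivB derivX -polyC1 derivC sub0r scalerN alg_polyC polyCN.
have ref_intU k : ref_int (U y k) = \sum_(j < K.+1) y (k * K + j)%N * gl_weight R K j.
  by rewrite ref_int_sum; apply: eq_bigr => j _; rewrite ref_int_Z gl_weightE.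
have w0 := gl_weight_gt0 (leq0n K); have wK := gl_weight_gt0 (leqnn K).
have KN : (K + K <= NK)%N by rewrite addnn -muln2 mulnC leq_mul2r N2 orbT.
have Y0 : ref_int (U y 0) = - (2 * s * lam / dx).
  rewrite ref_intU (bigD1 ord0)//= big1 ?addr0 => [|j]; last first.
    rewrite -(inj_eq val_inj)/= mul0n add0n => j0.
    have jK : (j < NK)%N by have := ltn_ord j; lia.
    by rewrite /y /z gtn_eqF// [(0 == _)%N]eq_sym (negPf j0) !mulr0 subrr mulr0 mul0r mul0r.
  rewrite mul0n addn0 /y /z nodal_mass0 eqxx gtn_eqF; last by lia.
  rewrite mulr0 sub0r mulr1; move: s => s'; by field; rewrite !gt_eqF.
have Y1 : ref_int (U y 1) = (N == 2%N)%:R * (2 * s * lam / dx).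
  rewrite ref_intU (bigD1 ord_max)//= big1 ?addr0 => [|j]; last first.
    rewrite -(inj_eq val_inj)/= mul1n => jK'.
    have jK : (K + j < NK)%N by have := ltn_ord j; lia.
    rewrite /y /z gtn_eqF// ltn_eqF ?addn_gt0 ?K_gt0//.
    by rewrite !mulr0 subrr mulr0 mul0r mul0r.
  have [N2E|N2E] := eqVneq N 2%N; last first.
    rewrite mul0r mul1n /y /z (gtn_eqF (_ : _ < NK)%N); last first.
      have : (2 < N)%N by rewrite ltn_neqAle eq_sym N2E.
      by rewrite -(ltn_pmul2r K_gt0); lia.
    by rewrite ltn_eqF ?addn_gt0 ?K_gt0// !mulr0 subrr mulr0 mul0r mul0r.
  have e : (1 * K + K = NK)%N by lia.
  rewrite e /y /z nodal_massN eqxx N2E ltn_eqF ?muln_gt0//.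
  rewrite (_ : s ^+ 3 = s); last by rewrite exprS sqrr_sign mulr1.
  rewrite mulr0 subr0 mulr1 mul1r; move: s => s'; by field; rewrite !gt_eqF.
rewrite !UQ dQ0 dQ1 !mul_polyC !ref_int_Z Y0 Y1 !cell_fun_w !ref_int_deriv !horner_cell_w.
rewrite legendre_m1 expr0 expr1 !mul1r.
have m0 : lam / dx != 0 by rewrite mulf_neq0 ?legendre1_neq0// invr_eq0 gt_eqF.
have -> (c : R) : 2 * c * lam / dx = 2 * c * (lam / dx) by rewrite mulrA.
have -> (c d : R) : 2 / dx * (c * (lam - d * lam)) = 2 * c * (1 - d) * (lam / dx).
  by field; rewrite gt_eqF.
have -> (c d : R) : 2 / dx * (c * (d * lam - d * (d * lam))) =
    2 * c * (d - d ^+ 2) * (lam / dx).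
  by field; rewrite gt_eqF.
rewrite sqrr_sign -signr_odd; case: (odd K); case: (N == 2%N);
  rewrite /= ?mulr1n ?mulr0n ?expr1 ?expr0; move: m0; move: (lam / dx) => m m0 e;
  move/eqP: m0; apply; lra.
Qed.

End operators.

Theorem corollary5p1 (R : realType) (K N : nat) (x0 dx : R)
    (hK : (1 <= K)%N) (hN : (1 <= N)%N) (hdx : 0 < dx) :
  let one := nodal K N x0 dx (fun=> 1) in
  let xx := nodal K N x0 dx (fun x => x) in
  [/\ ker (mx_Dxx K N x0 dx) = <<[:: one; xx]>>%VS,
      (<<[:: one; xx]>> <= ker (mx_Zx K N x0 dx))%VS
    & exists w : 'cV[R]_(N * K).+1,
      [/\ ker (mx_Dx K N x0 dx) = <<[:: one; w]>>%VS,
          ~ constant_on (omega N x0 dx) (fe_fun x0 dx w),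
          forall i : nat, (0 < i < N)%N ->
            derivative_jump (fe_fun x0 dx w) (cell_bound x0 dx i)
        & (2 <= N)%N -> w \notin ker (mx_Zx K N x0 dx)]].
Proof.
move=> one xx; split.
- apply/eqP; rewrite eqEsubv span_pair !mem_ker; apply/andP; split.
    apply/subvP => u; have [v ->] := coef_vec_surj u; rewrite mem_ker => /eqP.
    by move=> /(ker_Dxx hK hN hdx)[c [d ->]]; exact: mem_span_pair.
  by rewrite mulDxx_one// mulDxx_pos// eqxx.
- by rewrite span_pair !mem_ker mulZx_one// mulZx_pos// eqxx.
exists (coef_vec K N (glue K (cell_w R K))); split.
- apply/eqP; rewrite eqEsubv span_pair !mem_ker; apply/andP; split.
    apply/subvP => u; have [v ->] := coef_vec_surj u; rewrite mem_ker => /eqP.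
    by move=> /(ker_Dx hK hN hdx)[c [d ->]]; exact: mem_span_pair.
  by rewrite mulDx_one// mulDx_w// eqxx.
- exact: w_nonconstant.
- by move=> i; exact: w_jump.
- by move=> N2; rewrite mem_ker mulZx_w_neq0.
Qed.
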